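(* Let $X$ and $Y$ be Tychonoff spaces such that $C_p(X,\mathbb{T})$ and $C_p(Y,\mathbb{T})$ are topologically isomorphic. Then: (i) $X$ is pseudocompact iff $Y$ is; (ii) $l^*(X)=l^*(Y)$; (iii) $X$ is a Lindel\''of $\Sigma$-space iff $Y$ is; (iv) $X$ is $\sigma$-compact iff $Y$ is; (v) $X$ is compact iff $Y$ is; (vi) $X$ is compact metrizable iff $Y$ is; (vii) $X$ has exactly $n$ connected components (for a given positive integer $n$) iff $Y$ does; (viii) $X$ is connected iff $Y$ is; (ix) $X$ is totally disconnected iff $Y$ is.
   Context: $\mathbb{T}=\mathbb{R}/\mathbb{Z}$; $C_p(X,\mathbb{T})$ is the group of continuous maps $X\to\mathbb{T}$ with pointwise operations and topology of pointwise convergence. $l(\cdot)$ is the Lindel\''of number and $l^*(X)=\sup\{l(X^n):n\in\mathbb{N}\}$. A space is totally disconnected if any two distinct points are separated by a clopen set. *)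

(* Defs.v *)
From HB Require Import structures.
From mathcomp Require Import all_boot all_order all_algebra.
From mathcomp Require Import all_classical all_reals all_analysis.
Import Order.TTheory GRing.Theory Num.Theory.
Import numFieldNormedType.Exports.
Local Open Scope classical_set_scope.
Local Open Scope ring_scope.

Definition tychonoff_space (R : realType) (X : topologicalType) : Prop :=
  hausdorff_space X /\ completely_regular_space X.

(** The circle group T = R/Z, realised (as a topological group) as the unit
    circle S^1 in R x R (t mod 1 |-> (cos 2 pi t, sin 2 pi t)), with complex
    multiplication as the group law. *)
Definition circle (R : realType) : set (R * R) :=
  [set p | p.1 ^+ 2 + p.2 ^+ 2 = 1].

Definition circle_mul {R : realType} (p q : R * R) : R * R :=
  (p.1 * q.1 - p.2 * q.2, p.1 * q.2 + p.2 * q.1).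

Definition CT (R : realType) (X : topologicalType) : set {ptws X -> (R * R)%type} :=
  [set f | continuous (f : X -> R * R) /\ forall x, circle R (f x)].

Definition CT_mul {R : realType} {X : Type} (f g : X -> R * R) : X -> R * R :=
  fun x => circle_mul (f x) (g x).

Definition Cp_top_isomorphic (R : realType) (X Y : topologicalType) : Prop :=
  exists (Phi : {ptws X -> (R * R)%type} -> {ptws Y -> (R * R)%type})
         (Psi : {ptws Y -> (R * R)%type} -> {ptws X -> (R * R)%type}),
    [/\ (forall f, CT R X f -> CT R Y (Phi f)),
        (forall g, CT R Y g -> CT R X (Psi g)),
        (forall f, CT R X f -> Psi (Phi f) = f),
        (forall g, CT R Y g -> Phi (Psi g) = g) &
     [/\ (forall f g, CT R X f -> CT R X g ->
            Phi (CT_mul f g) = CT_mul (Phi f) (Phi g)),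
         {within CT R X, continuous Phi} &
         {within CT R Y, continuous Psi}]].

Definition pseudocompact (R : realType) (X : topologicalType) : Prop :=
  forall f : X -> R, continuous f -> exists M : R, forall x, `|f x| <= M.

Definition lindelof_le (Z : topologicalType) (K : Type) : Prop :=
  forall U : set (set Z), (forall A, U A -> open A) -> \bigcup_(A in U) A = setT ->
    exists V : set (set Z), [/\ V `<=` U, (V #<= [set: K])%card &
                               \bigcup_(A in V) A = setT].

(** [lstar_le X K] : l*(X) = sup_n l(X^n) <= |K| (X^n with the product topology). *)
Definition lstar_le (X : topologicalType) (K : Type) : Prop :=
  forall n : nat, lindelof_le {ptws 'I_n -> X} K.

Definition lindelof_sigma (X : topologicalType) : Prop :=
  exists (N : nat -> set X) (C : set (set X)),
    [/\ (forall c, C c -> compact c), \bigcup_(c in C) c = setT &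
        forall c U, C c -> open U -> c `<=` U -> exists n, c `<=` N n /\ N n `<=` U].

Definition sigma_compact (X : topologicalType) : Prop :=
  exists K : nat -> set X, (forall n, compact (K n)) /\ \bigcup_n K n = setT.

Definition metrizable (R : realType) (X : topologicalType) : Prop :=
  exists d : X -> X -> R,
    [/\ (forall x y, d x y = 0 <-> x = y),
        (forall x y, d x y = d y x),
        (forall x y z, d x z <= d x y + d y z) &
        forall A : set X, open A <->
          (forall x, A x -> exists e : R, 0 < e /\ forall y, d x y < e -> A y)].

Definition components (X : topologicalType) : set (set X) :=
  [set connected_component [set: X] x | x in [set: X]].

Definition has_n_components (X : topologicalType) (n : nat) : Prop :=
  (components X #= `I_n)%card.

(* Main.v *)
(** Identify [T] with the unit circle. Since the circle has no small subgroups, a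
    character of [C_p(X, T)] that is continuous at the unit only depends on the
    values on a finite set, and bump functions reduce it to characters of the real
    line; hence it is a finite integer combination of evaluations. A topological
    isomorphism of [C_p(X, T)] with [C_p(Y, T)] therefore writes every point of [Y]
    as a finite integer combination of points of [X]. For given coefficients
    [n_1, ..., n_m] the tuples in [X^m] representing a point of [Y] form a closed
    set, on which the represented point depends continuously, so that [Y] is a
    countable union of continuous images of closed subspaces of finite powers of
    [X]: this gives (ii), (iii) and (iv).

    If [Y] is not pseudocompact then [C_p(Y, T)] contains locally finite families of
    nontrivial functions all of whose infinite products converge, which is
    impossible for a pseudocompact [X]; compactness is sigma-compactness together
    with pseudocompactness. Comparing coefficients of two points of [Y] shows that
    functions supported near one point of [X] separate them: a countable family of
    bumps suffices if [X] is compact metrizable, and indicators of clopen sets,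
    which become torsion elements, if [X] is totally disconnected. Finally the
    involutions of [C_p(X, T)] are the clopen subsets of [X], of which there are
    [2 ^ n] if [X] has [n] components. *)

Require Import Defs.
From HB Require Import structures.
From mathcomp Require Import all_boot all_order all_algebra.
From mathcomp Require Import all_classical all_reals all_analysis.
From mathcomp Require Import ring lra.
Import Order.TTheory GRing.Theory Num.Theory.
Import numFieldNormedType.Exports.
Local Open Scope classical_set_scope.
Local Open Scope ring_scope.

(** * The circle group *)

Section circle_group.
Variable R : realType.
Implicit Types (p q r : R * R) (s t : R).

Definition cone : R * R := (1, 0).

Definition cconj p : R * R := (p.1, - p.2).

Definition expi t : R * R := (cos t, sin t).

Definition cpow p (n : int) : R * R :=
  match n with
  | Posz k => iter k (circle_mul p) cone
  | Negz k => iter k.+1 (circle_mul (cconj p)) cone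
  end.

Lemma cmulC p q : circle_mul p q = circle_mul q p.
Proof. by rewrite /circle_mul; congr pair; ring. Qed.

Lemma cmulA p q r : circle_mul p (circle_mul q r) = circle_mul (circle_mul p q) r.
Proof. by rewrite /circle_mul /=; congr pair; ring. Qed.

Lemma cmul1p p : circle_mul cone p = p.
Proof. by case: p => a b; rewrite /circle_mul /=; congr pair; ring. Qed.

Lemma cmulp1 p : circle_mul p cone = p.
Proof. by rewrite cmulC cmul1p. Qed.

Lemma expiD s t : expi (s + t) = circle_mul (expi s) (expi t).
Proof. by rewrite /expi cosD sinD /circle_mul /=; congr pair; ring. Qed.

Lemma expi0 : expi 0 = cone.
Proof. by rewrite /expi cos0 sin0. Qed.

Lemma expipi : expi pi = (-1, 0).
Proof. by rewrite /expi cospi sinpi. Qed.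

Lemma circle_expi t : circle R (expi t).
Proof. exact: cos2Dsin2. Qed.

Lemma circle_lift p : circle R p -> exists2 t, `|t| <= pi & p = expi t.
Proof.
case: p => a b; rewrite /circle /= => ab1.
have b2 : b ^+ 2 = 1 - a ^+ 2 by rewrite -ab1; ring.
have a1 : -1 <= a <= 1.
  by rewrite -ler_norml -ler_sqr ?nnegrE// real_normK ?num_real// expr1n -ab1
    lerDl sqr_ge0.
have ca : cos (acos a) = a by rewrite acosK// in_itv.
have sa : sin (acos a) = `|b| by rewrite sin_acos// -b2 sqrtr_sqr.
have a0 := acos_ge0 a1; have api := acos_lepi a1.
case: (leP 0 b) => b0.
  by exists (acos a); [rewrite ger0_norm|rewrite /expi ca sa ger0_norm].
exists (- acos a); first by rewrite normrN ger0_norm.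
by rewrite /expi cosN sinN ca sa ltr0_norm// opprK.
Qed.

Lemma cmulpV p : circle R p -> circle_mul p (cconj p) = cone.
Proof.
by case: p => a b; rewrite /circle /circle_mul /cone /= => <-; congr pair; ring.
Qed.

Lemma expiN t : expi (- t) = cconj (expi t).
Proof. by rewrite /expi cosN sinN. Qed.

Lemma circle_cmul p q : circle R p -> circle R q -> circle R (circle_mul p q).
Proof.
by move=> /circle_lift[s _ ->] /circle_lift[t _ ->]; rewrite -expiD; exact: circle_expi.
Qed.

Lemma circle1 : circle R cone.
Proof. by rewrite -expi0; exact: circle_expi. Qed.

Lemma circle_conj p : circle R p -> circle R (cconj p).
Proof. by move=> /circle_lift[s _ ->]; rewrite -expiN; exact: circle_expi. Qed.

Lemma cmul_inj p q r : circle R p -> circle_mul p q = circle_mul p r -> q = r.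
Proof.
move=> cp /(congr1 (circle_mul (cconj p))).
by rewrite !cmulA ![circle_mul (cconj p) p]cmulC cmulpV// !cmul1p.
Qed.

Lemma iter_expi t k : iter k (circle_mul (expi t)) cone = expi (k%:R * t).
Proof.
elim: k => [|k IH] /=; first by rewrite mul0r expi0.
by rewrite IH -expiD mulrSr mulrDl mul1r addrC.
Qed.

Lemma cpow_expi t n : cpow (expi t) n = expi (n%:~R * t).
Proof.
case: n => k; first exact: iter_expi.
by rewrite /cpow -expiN iter_expi NegzE intrN mulrN mulNr.
Qed.

Lemma circle_cpow p n : circle R p -> circle R (cpow p n).
Proof. by move=> /circle_lift[s _ ->]; rewrite cpow_expi; exact: circle_expi. Qed.

Lemma cpow1 n : cpow cone n = cone.
Proof. by rewrite -expi0 cpow_expi mulr0. Qed.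

Section convergence.
Context (T : Type) (F : set_system T) {FF : Filter F}.

Lemma pair_cvg (f g : T -> R) (a b : R) :
  f @ F --> a -> g @ F --> b -> (fun x => (f x, g x)) @ F --> (a, b).
Proof. by move=> fa gb; exact: (cvg_pair fa gb). Qed.

Lemma fst_cvg (f : T -> R * R) p : f @ F --> p -> (fun x => (f x).1) @ F --> p.1.
Proof. by move=> fp; apply: (cvg_comp f fst fp); exact: cvg_fst. Qed.

Lemma snd_cvg (f : T -> R * R) p : f @ F --> p -> (fun x => (f x).2) @ F --> p.2.
Proof. by move=> fp; apply: (cvg_comp f snd fp); exact: cvg_snd. Qed.

Lemma cmul_cvg (f g : T -> R * R) p q : f @ F --> p -> g @ F --> q ->
  (fun x => circle_mul (f x) (g x)) @ F --> circle_mul p q.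
Proof.
move=> fp gq; have f1 := fst_cvg _ _ fp; have f2 := snd_cvg _ _ fp.
have g1 := fst_cvg _ _ gq; have g2 := snd_cvg _ _ gq.
by apply: pair_cvg; [apply: cvgB|apply: cvgD]; apply: cvgM.
Qed.

Lemma cconj_cvg (f : T -> R * R) p : f @ F --> p ->
  (fun x => cconj (f x)) @ F --> cconj p.
Proof.
move=> fp; apply: pair_cvg; first exact: (fst_cvg _ _ fp).
by apply: cvgN; exact: (snd_cvg _ _ fp).
Qed.

Lemma cpow_cvg (f : T -> R * R) p n : f @ F --> p ->
  (fun x => cpow (f x) n) @ F --> cpow p n.
Proof.
have it (g : T -> R * R) q k : g @ F --> q ->
    (fun x => iter k (circle_mul (g x)) cone) @ F --> iter k (circle_mul q) cone.
  move=> gq; elim: k => [|k IH]; first exact: cvg_cst.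
  exact: (cmul_cvg _ _ _ _ gq IH).
move=> fp; case: n => k; first exact: it.
by apply: (it (fun x => cconj (f x)) (cconj p) k.+1); exact: cconj_cvg.
Qed.

End convergence.

Lemma continuous_expi : continuous expi.
Proof.
by move=> t; apply: pair_cvg; [exact: continuous_cos|exact: continuous_sin].
Qed.

Lemma cos_le0_3pihalf t : pi / 2 <= t <= pi + pi / 2 -> cos t <= 0.
Proof.
move=> /andP[t1 t2]; rewrite -[t](subrK pi) cosDpi oppr_le0.
apply: cos_ge0_pihalf; lra.
Qed.

Lemma circle_no_small_subgroups p : circle R p ->
  (forall k, 0 < (iter k (circle_mul p) cone).1) -> p = cone.
Proof.
move=> /circle_lift[t tpi ->] tk.
have [->|t0] := eqVneq t 0; first exact: expi0.
have t1 : 0 < `|t| by rewrite normr_gt0.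
have pi0 := pi_gt0 R.
have ex : exists k, pi / 2 <= k%:R * `|t|.
  exists (Num.trunc (pi / 2 / `|t|)).+1.
  rewrite -ler_pdivrMr//; apply: ltW; exact: truncnS_gt.
case: (ex_minnP ex) => k kt kmin.
case: k kt kmin => [|k] kt kmin; first by move: kt; rewrite mul0r => kt; exfalso; lra.
have kt2 : k%:R * `|t| < pi / 2.
  rewrite ltNge; apply/negP => /kmin; by rewrite ltnn.
have := tk k.+1; rewrite iter_expi /=.
rewrite -[cos _]cos_norm normrM normr_nat ltNge => /negP; case.
apply: cos_le0_3pihalf; rewrite kt /= -natr1 mulrDl mul1r.
lra.
Qed.

Lemma cos_gt_lt t u : 0 <= u <= pi -> `|t| <= pi -> cos u < cos t -> `|t| < u.
Proof.
move=> u0 tpi; rewrite -(cos_norm t) ltr_cos// in_itv//=.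
by rewrite normr_ge0.
Qed.

Lemma real_character (phi : R -> R * R) (d : R) : 0 < d ->
  (forall s, circle R (phi s)) ->
  (forall s t, phi (s + t) = circle_mul (phi s) (phi t)) ->
  (forall s, `|s| <= d -> cos (pi / 4) < (phi s).1) ->
  exists c, forall s, phi s = expi (c * s).
Proof.
move=> d0 cphi phiD phid; have pi0 := pi_gt0 R.
have small s : `|s| <= d -> exists2 b, `|b| < pi / 4 & phi s = expi b.
  move=> sd; have [b bpi E] := circle_lift _ (cphi s).
  exists b => //; apply: cos_gt_lt => //; first lra.
  by have := phid _ sd; rewrite E.
have [a api Ed] := small d (ltac:(by rewrite gtr0_norm)).
exists (a / d) => s.
pose psi s := circle_mul (phi s) (expi (- (a / d * s))).
have cpsi s' : circle R (psi s') by apply: circle_cmul => //; exact: circle_expi.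
have psiD s' t : psi (s' + t) = circle_mul (psi s') (psi t).
  rewrite /psi phiD mulrDr opprD expiD -!cmulA; congr circle_mul.
  by rewrite !cmulA; congr circle_mul; rewrite cmulC.
have psid : psi d = cone.
  by rewrite /psi Ed -expiD -mulrA mulVf ?gt_eqF// mulr1 subrr expi0.
have psi0 : psi 0 = cone.
  by apply: (@cmul_inj (psi 0)) => //; rewrite -psiD addr0 cmulp1.
have psikd k : psi (k%:R * d) = cone.
  elim: k => [|k IH]; first by rewrite mul0r.
  by rewrite -natr1 mulrDl mul1r psiD IH psid cmul1p.
have psi_small s' : 0 <= s' <= d -> 0 < (psi s').1.
  move=> /andP[s0 sd]; have [b bpi E] := small s' (ltac:(by rewrite ger0_norm)).
  rewrite /psi E -expiD /=; apply: cos_gt0_pihalf.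
  have : `|a / d * s'| < pi / 4.
    rewrite normrM normrM normfV (gtr0_norm d0) (ger0_norm s0).
    apply: le_lt_trans api; rewrite -mulrA ler_piMr// mulrC ler_pdivrMr//.
    by rewrite mul1r.
  by move: bpi; rewrite !ltr_norml; lra.
have psi_pos s' : 0 <= s' -> 0 < (psi s').1.
  move=> s0; pose k := Num.trunc (s' / d).
  have sd0 : 0 <= s' / d by rewrite divr_ge0// ltW.
  have /andP[k1 k2] := truncn_itv sd0; rewrite -/k in k1 k2.
  rewrite -[s'](subrK (k%:R * d)) psiD psikd cmulp1; apply: psi_small.
  move: k1 k2; rewrite ler_pdivlMr// ltr_pdivrMr// -natr1 mulrDl mul1r; lra.
have psi1 s' : 0 <= s' -> psi s' = cone.
  move=> s0; apply: circle_no_small_subgroups => // k.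
  have -> : iter k (circle_mul (psi s')) cone = psi (k%:R * s').
    elim: k => [|k IH] /=; first by rewrite mul0r.
    by rewrite IH -psiD mulrSr mulrDl mul1r addrC.
  by apply: psi_pos; rewrite mulr_ge0.
have psi1' s' : psi s' = cone.
  case: (leP 0 s') => s0; first exact: psi1.
  apply: (@cmul_inj (psi (- s'))) => //.
  by rewrite -psiD addNr psi0 psi1 ?oppr_ge0 ?ltW// cmul1p.
have := psi1' s; rewrite /psi => E.
apply: (@cmul_inj (expi (- (a / d * s)))); first exact: circle_expi.
by rewrite cmulC E -expiD addNr expi0.
Qed.

Lemma expi_2pi (z : int) : expi (z%:~R * (pi *+ 2)) = cone.
Proof.
by rewrite -cpow_expi {1}/expi cos2pi sin2pi cpow1.
Qed.

Lemma expi_eq1 t : expi t = cone -> exists z : int, t = z%:~R * (pi *+ 2).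
Proof.
move=> t1; have pi0 := pi_gt0 R.
pose z := Num.floor (t / (pi *+ 2)); exists z.
have pi2 : 0 < pi *+ 2 :> R by rewrite pmulrn_lgt0.
have /andP[] : z%:~R <= t / (pi *+ 2) < (z + 1)%:~R.
  exact: floor_itv.
rewrite ler_pdivlMr// ltr_pdivrMr// intrD mulrDl mul1r => z1 z2.
set r := t - z%:~R * (pi *+ 2).
have r1 : expi r = cone.
  by rewrite /r expiD t1 -mulNr -intrN expi_2pi cmul1p.
suff : r = 0 by rewrite /r => /eqP; rewrite subr_eq0 => /eqP.
apply/eqP/negP => /negP r0.
have sr : 0 < sin (r / 2).
  apply: sin_gt0_pi; rewrite /r in r0 *.
  have : t - z%:~R * (pi *+ 2) > 0 by rewrite lt_neqAle eq_sym r0 subr_ge0.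
  by move: z2; rewrite mulr2n; lra.
have := congr1 fst r1; rewrite /= -[r]divr1 -(@divff _ 2)// invfM invrK mulrA.
rewrite mulr_natr cos_mulr2n cos2sin2 mulr2n => E.
have : sin (r / 2) ^+ 2 = 0 by lra.
by move=> /eqP; rewrite sqrf_eq0 gt_eqF.
Qed.

Lemma expi_int_period (c : R) : expi (c * (pi *+ 2)) = cone ->
  exists n : int, c = n%:~R.
Proof.
move=> /expi_eq1[n E]; exists n.
have pi2 : pi *+ 2 != 0 :> R by rewrite lt0r_neq0// pmulrn_lgt0// pi_gt0.
exact: (mulIf pi2 E).
Qed.

End circle_group.


(** * Pointwise topologies and separation by continuous functions *)

Lemma ptws_cvg (I : Type) (T : topologicalType) (F : set_system {ptws I -> T})
    (f : {ptws I -> T}) : Filter F ->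
  (forall i, (fun g : {ptws I -> T} => g i) @ F --> f i) -> F --> f.
Proof.
move=> FF Ff; apply/cvg_sup => i U [W [[A oA <- /=]]] Af /filterS; apply.
by apply: Ff; exact: open_nbhs_nbhs.
Qed.

Lemma ptws_proj_continuous (I : eqType) (T : topologicalType) (i : I) :
  continuous (fun g : {ptws I -> T} => g i).
Proof. exact: (@proj_continuous I (fun=> T) i). Qed.

Lemma continuous_ptws (I : Type) (S T : topologicalType) (f : S -> {ptws I -> T}) :
  (forall i, continuous (fun x => f x i)) -> continuous f.
Proof. by move=> cf x; apply: ptws_cvg => i; exact: cf. Qed.

Lemma ptws_nbhs_box (I : Type) (T : topologicalType) (y : {ptws I -> T})
    (V : set {ptws I -> T}) : nbhs y V ->
  exists2 W : I -> set T, (forall i, nbhs (y i) (W i)) &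
    forall z, (forall i, W i (z i)) -> V z.
Proof.
pose box (W : I -> set T) : set {ptws I -> T} := [set z | forall i, W i (z i)].
pose D := [set W : I -> set T | forall i, nbhs (y i) (W i)].
have FF : Filter (filter_from D box).
  apply: filter_from_filter; first by exists (fun=> setT) => i; exact: filterT.
  move=> W W' DW DW'; exists (fun i => W i `&` W' i); first by move=> i; exact: filterI.
  by move=> z zW; split=> i; case: (zW i).
suff Fy : filter_from D box --> y by move=> /Fy[W DW WV]; exists W.
apply: ptws_cvg => i A Ay /=; exists (fun j => [set t | j = i -> A t]).
  move=> j; have [->|ji] := pselect (j = i); first by apply: filterS Ay => t At _.
  by apply: filterS filterT => t _ /ji.
by move=> z /(_ i); exact.
Qed.

Section bumps.
Variables (R : realType) (X : topologicalType).
Hypothesis tX : tychonoff_space R X.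

Lemma tychonoff_bump (x : X) (V : set X) : nbhs x V ->
  exists b : X -> R, [/\ continuous b, forall z, 0 <= b z <= 1, b x = 1 &
    forall z, ~ V z -> b z = 0].
Proof.
rewrite nbhsE => -[A [oA Ax] AV].
have := tX.2 x (~` A) (open_closedC oA) (ltac:(by apply)).
move=> /(@uniform_separatorP _ R)[f [cf f01 fx fA]].
exists (fun z => 1 - f z); split.
- by move=> z; apply: cvgB; [exact: cvg_cst|exact: cf].
- move=> z; have : f z \in `[0, 1] by apply: f01; exists z.
  by rewrite in_itv /=; lra.
- by rewrite (fx (f x)) ?subr0//; exists x.
- move=> z Vz; rewrite (fA (f z)) ?subrr//; exists z => // Az.
  exact/Vz/AV.
Qed.

Lemma tychonoff_bump_point (x : X) (F : seq X) :
  exists b : X -> R, [/\ continuous b, forall z, 0 <= b z <= 1, b x = 1 &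
    forall z, z \in F -> z != x -> b z = 0].
Proof.
have accX := hausdorff_accessible tX.1.
elim: F => [|y F [b [cb b01 bx bF]]].
  exists (fun=> 1); split => //; [exact: cst_continuous|by move=> z; rewrite lexx ler01].
have [yx|yx] := eqVneq y x.
  exists b; split => // z; rewrite inE => /orP[/eqP->|]; last exact: bF.
  by rewrite yx eqxx.
have [c [cc c01 cx cy]] : exists c : X -> R, [/\ continuous c,
    forall z, 0 <= c z <= 1, c x = 1 & forall z, ~ (~` [set y]) z -> c z = 0].
  apply: tychonoff_bump; apply: (@open_nbhs_nbhs _ x (~` [set y])); split.
    by rewrite openC; exact: accessible_closed_set1.
  by move=> /= xy; rewrite xy eqxx in yx.
exists (fun z => b z * c z); split.
- by move=> z; apply: cvgM; [exact: cb|exact: cc].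
- move=> z; have /andP[b0 b1] := b01 z; have /andP[c0 c1] := c01 z.
  by rewrite mulr_ge0//= mulr_ile1.
- by rewrite bx cx mulr1.
- move=> z; rewrite inE => /orP[/eqP->|zF] zx; last by rewrite bF// mul0r.
  by rewrite cy ?mulr0//=; apply.
Qed.

Lemma tychonoff_bump_seq (F : seq X) (V : set X) :
  (forall x, x \in F -> nbhs x V) ->
  exists b : X -> R, [/\ continuous b, forall z, 0 <= b z <= 1,
    forall x, x \in F -> b x = 1 & forall z, ~ V z -> b z = 0].
Proof.
elim: F => [_|y F IH FV].
  exists (fun=> 0); split => //; [exact: cst_continuous|by move=> z; rewrite lexx ler01].
have [x xF|b [cb b01 bF bV]] := IH; first by apply: FV; rewrite inE xF orbT.
have [|c [cc c01 cy cV]] := @tychonoff_bump y V; first by apply: FV; rewrite inE eqxx.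
exists (fun z => 1 - (1 - b z) * (1 - c z)); split.
- move=> z; apply: cvgB; first exact: cvg_cst.
  by apply: cvgM; (apply: cvgB; [exact: cvg_cst|]); [exact: cb|exact: cc].
- move=> z; have /andP[b0 b1] := b01 z; have /andP[c0 c1] := c01 z.
  have : 0 <= (1 - b z) * (1 - c z) by apply: mulr_ge0; lra.
  have : (1 - b z) * (1 - c z) <= 1 by apply: mulr_ile1; lra.
  by lra.
- move=> z; rewrite inE => /orP[/eqP->|zF]; first by rewrite cy subrr mulr0 subr0.
  by rewrite bF// subrr mul0r subr0.
- by move=> z Vz; rewrite bV// cV// subr0 mulr1 subrr.
Qed.

End bumps.

(** * Characters of the group of circle-valued functions *)

Section CT_group.
Variables (R : realType) (X : topologicalType).
Implicit Types f g : X -> R * R.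

Lemma CT_circle f x : CT R X f -> circle R (f x).
Proof. by case. Qed.

Lemma CT_CT_mul f g : CT R X f -> CT R X g -> CT R X (CT_mul f g).
Proof.
move=> [cf Cf] [cg Cg]; split; last by move=> x; exact: circle_cmul.
by move=> x; exact: (cmul_cvg _ _ _ _ _ _ _ (cf x) (cg x)).
Qed.

Lemma CT_conj f : CT R X f -> CT R X (fun x => cconj _ (f x)).
Proof.
move=> [cf Cf]; split; last by move=> x; exact: circle_conj.
by move=> x; exact: cconj_cvg (cf x).
Qed.

Lemma CT_cst p : circle R p -> CT R X (fun=> p).
Proof. by move=> cp; split => //; exact: cst_continuous. Qed.

Lemma CT_expi (b : X -> R) : continuous b -> CT R X (fun x => expi R (b x)).
Proof.
move=> cb; split => x; last exact: circle_expi.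
by apply: (cvg_comp b (expi R) (cb x)); exact: continuous_expi.
Qed.

Lemma CT_expiZ (b : X -> R) (s : R) : continuous b ->
  CT R X (fun x => expi R (s * b x)).
Proof.
by move=> cb; apply: CT_expi => x; apply: cvgM; [exact: cvg_cst|exact: cb].
Qed.

End CT_group.

HB.instance Definition _ (R : realType) := Monoid.isComLaw.Build (R * R)%type
  (cone R) (@circle_mul R) (@cmulA R) (@cmulC R) (@cmul1p R).

(* The last condition is a weak form of continuity at the unit for the topology
   of pointwise convergence: [F] and [U] describe a basic neighbourhood. *)
Definition character (R : realType) (X : topologicalType)
    (chi : (X -> R * R) -> R * R) (F : seq X) : Prop :=
  [/\ forall f, CT R X f -> circle R (chi f),
      forall f g, CT R X f -> CT R X g ->
        chi (CT_mul f g) = circle_mul (chi f) (chi g) &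
      exists2 U, nbhs (cone R) U & forall f, CT R X f ->
        (forall x, x \in F -> U (f x)) -> cos (pi / 4) < (chi f).1].

Section characters.
Variables (R : realType) (X : topologicalType).
Variables (chi : (X -> R * R) -> R * R) (F : seq X).
Hypothesis chiF : character R X chi F.
Notation one := (cone R).

Lemma character_one : chi (fun=> one) = one.
Proof.
have [c1 c2 _] := chiF; have C1 : CT R X (fun=> one) by apply: CT_cst; exact: circle1.
apply: (@cmul_inj R (chi (fun=> one))); first exact: c1.
rewrite -c2// cmulp1; congr chi; apply/funext => x.
by rewrite /CT_mul cmulp1.
Qed.

Lemma character_ker f : CT R X f -> (forall x, x \in F -> f x = one) -> chi f = one.
Proof.
move=> Cf fF; have [c1 c2 [U Ux c3]] := chiF.
have pw k : CT R X (fun x => iter k (circle_mul (f x)) one) /\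
    chi (fun x => iter k (circle_mul (f x)) one) = iter k (circle_mul (chi f)) one.
  elim: k => [|k [Ck IH]] /=.
    by split; [apply: CT_cst; exact: circle1|exact: character_one].
  by split; [exact: CT_CT_mul|rewrite -IH -c2].
apply: circle_no_small_subgroups; first exact: c1.
move=> k; have [Ck <-] := pw k; apply: lt_trans (c3 _ Ck _).
  by apply: cos_gt0_pihalf; have := pi_gt0 R; lra.
move=> x xF; rewrite fF//.
have -> : iter k (circle_mul one) one = one by elim: k {Ck} => //= k ->; rewrite cmul1p.
exact: nbhs_singleton.
Qed.

Lemma character_eq f g : CT R X f -> CT R X g ->
  (forall x, x \in F -> f x = g x) -> chi f = chi g.
Proof.
move=> Cf Cg fg; have [c1 c2 _] := chiF.
have Ch := CT_conj _ _ _ Cg.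
have e h : CT R X h -> (forall x, x \in F -> h x = g x) ->
    circle_mul (chi (fun x => cconj R (g x))) (chi h) = one.
  move=> Ck hg; rewrite -c2//; apply: character_ker; first exact: CT_CT_mul.
  move=> x xF; rewrite /CT_mul hg// cmulC cmulpV//; exact: CT_circle.
apply: (@cmul_inj R (chi (fun x => cconj R (g x)))); first exact: c1.
by rewrite !e.
Qed.

Lemma character_prod (s : seq X) (g : X -> X -> R * R) :
  (forall x, CT R X (g x)) ->
  CT R X (fun y => \big[@circle_mul R/one]_(x <- s) g x y) /\
  chi (fun y => \big[@circle_mul R/one]_(x <- s) g x y) =
  \big[@circle_mul R/one]_(x <- s) chi (g x).
Proof.
move=> Cg; have [c1 c2 _] := chiF; elim: s => [|x s [Cs IH]].
  under eq_fun do rewrite big_nil; rewrite big_nil.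
  by split; [apply: CT_cst; exact: circle1|exact: character_one].
under eq_fun do rewrite big_cons; rewrite big_cons -IH -c2//.
by split => //; exact: CT_CT_mul.
Qed.

(** Bump functions reduce a character to finitely many characters of the real
    line, one for each point of [F]. *)
Lemma character_repr : tychonoff_space R X ->
  exists n : X -> int, forall f, CT R X f ->
    chi f = \big[@circle_mul R/one]_(x <- undup F) cpow R (f x) (n x).
Proof.
move=> tX; have [c1 c2 [U U1 c3]] := chiF.
have /choice[b bP] := fun x => tychonoff_bump_point R X tX x F.
have [d d0 dU] : exists2 d : R, 0 < d & forall s, `|s| <= d -> U (expi R s).
  have : nbhs (0 : R) (fun s => U (expi R s)).
    by apply: continuous_expi; rewrite expi0.
  move=> /nbhs_ballP[d /= d0 dU]; exists (d / 2); first by rewrite divr_gt0.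
  by move=> s sd; apply: dU; rewrite /ball /= sub0r normrN; lra.
have Cb x s : CT R X (fun y => expi R (s * b x y)).
  by apply: CT_expiZ; case: (bP x).
have /choice[n nP] : forall x, exists n : int, x \in F ->
    forall s, chi (fun y => expi R (s * b x y)) = expi R (n%:~R * s).
  move=> x; have [xF|] := boolP (x \in F); last by exists 0.
  have [cb b01 bx bF] := bP x.
  have [|||c cE] := @real_character R (fun s => chi (fun y => expi R (s * b x y))) d d0.
  - by move=> s; exact: c1.
  - move=> s t; rewrite -c2//; congr chi; apply/funext => y.
    by rewrite mulrDl expiD.
  - move=> s sd; apply: c3 => // y yF; apply: dU; rewrite normrM.
    have /andP[b0 b1] := b01 y; rewrite (ger0_norm b0).
    by apply: le_trans sd; rewrite ler_piMr.
  have [n nE] : exists n : int, c = n%:~R.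
    apply: expi_int_period; rewrite -cE; apply: character_ker => // y yF.
    have [->|yx] := eqVneq y x; last by rewrite bF// mulr0 expi0.
    by rewrite bx mulr1 /expi cos2pi sin2pi.
  by exists n => _ s; rewrite cE nE.
exists n => f Cf.
have /choice[t tP] : forall x, exists t, f x = expi R t.
  by move=> x; have [t _ ->] := circle_lift _ _ (CT_circle _ _ f x Cf); exists t.
have [Cg gE] := character_prod (undup F) _ (fun x => Cb x (t x)).
rewrite (character_eq f _ Cf Cg) ?gE.
  rewrite !big_seq; apply: eq_bigr => x; rewrite mem_undup => xF.
  by rewrite nP// tP cpow_expi.
move=> x xF; rewrite (bigD1_seq x) ?mem_undup ?undup_uniq//= big_seq_cond big1.
  by have [_ _ -> _] := bP x; rewrite mulr1 cmulp1 tP.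
move=> y /andP[]; rewrite mem_undup => yF yx.
by have [_ _ _ ->] := bP y; rewrite // 1?eq_sym// mulr0 expi0.
Qed.

End characters.

Section characters_of_isomorphisms.
Variables (R : realType) (X Y : topologicalType).

Lemma ptws_one_nbhs_basis (F : set {ptws X -> (R * R)%type}) :
  nbhs ((fun=> cone R) : {ptws X -> (R * R)%type}) F ->
  exists (s : seq X) (U : set (R * R)), nbhs (cone R) U /\
    forall f, (forall x, x \in s -> U (f x)) -> F f.
Proof.
pose D := [set i : seq X * set (R * R) | nbhs (cone R) i.2].
pose B (i : seq X * set (R * R)) : set {ptws X -> (R * R)%type} :=
  [set f | forall x, x \in i.1 -> i.2 (f x)].
have FB : Filter (filter_from D B).
  apply: filter_from_filter; first by exists ([::], setT); exact: filterT.
  move=> [s U] [s' U'] DU DU'; exists (s ++ s', U `&` U'); first exact: filterI.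
  move=> f sf; split => x xs; case: (sf x) => //=; by rewrite mem_cat xs ?orbT.
suff cB : filter_from D B --> ((fun=> cone R) : {ptws X -> (R * R)%type}).
  by move=> /cB[[s U] DU sU]; exists s, U.
apply: ptws_cvg => x A Ax; exists ([:: x], A) => // f; apply; exact: mem_head.
Qed.

Lemma evaluation_character (Phi : {ptws X -> (R * R)%type} -> {ptws Y -> (R * R)%type})
    (y : Y) :
  (forall f, CT R X f -> CT R Y (Phi f)) ->
  (forall f g, CT R X f -> CT R X g -> Phi (CT_mul f g) = CT_mul (Phi f) (Phi g)) ->
  {within CT R X, continuous Phi} ->
  exists F, character R X (fun f => Phi f y) F.
Proof.
move=> PC Pm /subspace_continuousP Pc.
have C1 : CT R X (fun=> cone R) by apply: CT_cst; exact: circle1.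
have P1 : Phi (fun=> cone R) y = cone R.
  apply: (@cmul_inj R (Phi (fun=> cone R) y)); first by apply: CT_circle; exact: PC.
  have e : @CT_mul R X (fun=> cone R) (fun=> cone R) = fun=> cone R.
    by apply/funext => x; rewrite /CT_mul cmulp1.
  rewrite cmulp1.
  exact: (esym (congr1 (@^~ y) (etrans (congr1 Phi (esym e)) (Pm _ _ C1 C1)))).
have nV : nbhs (Phi (fun=> cone R) y) [set p : R * R | cos (pi / 4) < p.1].
  apply: open_nbhs_nbhs; split; last first.
    have p0 := pi_gt0 R; have p1 : 0 <= (pi : R) / 4 <= pi by lra.
    have p2 : 0 <= (0 : R) <= pi by lra.
    by rewrite P1 /= -[X in _ < X]cos0 ltr_cos ?in_itv//; lra.
  apply: (@open_comp _ _ fst [set r : R | cos (pi / 4) < r]).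
    by move=> p _; exact: cvg_fst.
  exact: open_gt.
have /(_ _ nV) := cvg_comp _ (fun f => f y) (Pc _ C1) (@ptws_proj_continuous Y _ y _).
move=> /ptws_one_nbhs_basis[s [U [U1 sU]]]; exists s; split.
- by move=> f Cf; apply: CT_circle; exact: PC.
- by move=> f g Cf Cg; rewrite Pm.
- by exists U => // f Cf /sU; exact.
Qed.


End characters_of_isomorphisms.

(** * Every point of [Y] is an integer combination of points of [X] *)

Section isomorphisms.
Variable R : realType.

Definition Cp_iso (X Y : topologicalType)
    (Phi : {ptws X -> (R * R)%type} -> {ptws Y -> (R * R)%type})
    (Psi : {ptws Y -> (R * R)%type} -> {ptws X -> (R * R)%type}) : Prop :=
  [/\ (forall f, CT R X f -> CT R Y (Phi f)),
      (forall g, CT R Y g -> CT R X (Psi g)),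
      (forall f, CT R X f -> Psi (Phi f) = f),
      (forall g, CT R Y g -> Phi (Psi g) = g) &
   [/\ (forall f g, CT R X f -> CT R X g ->
          Phi (CT_mul f g) = CT_mul (Phi f) (Phi g)),
       {within CT R X, continuous Phi} &
       {within CT R Y, continuous Psi}]].

Lemma Cp_iso_sym (X Y : topologicalType) Phi Psi :
  Cp_iso X Y Phi Psi -> Cp_iso Y X Psi Phi.
Proof.
move=> [PC QC QP PQ [Pm Pc Qc]]; split => //; split => // f g Cf Cg.
rewrite -{1}(PQ f)// -{1}(PQ g)// -Pm ?QP//; try exact: QC.
by apply: CT_CT_mul; exact: QC.
Qed.

Lemma Cp_iso_character (X Y : topologicalType) Phi Psi (y : Y) :
  Cp_iso X Y Phi Psi -> exists F, character R X (fun f => Phi f y) F.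
Proof. by move=> [PC _ _ _ [Pm Pc _]]; exact: evaluation_character. Qed.

Definition word (X : Type) m (n : {ffun 'I_m -> int}) (z : 'I_m -> X)
    (g : X -> R * R) : R * R :=
  \big[@circle_mul R/cone R]_(i < m) cpow R (g (z i)) (n i).

Lemma big_cmul_cvg (T I : Type) (F : set_system T) (s : seq I)
    (f : I -> T -> R * R) (p : I -> R * R) : Filter F ->
  (forall i, f i @ F --> p i) ->
  (fun x => \big[@circle_mul R/cone R]_(i <- s) f i x) @ F -->
    \big[@circle_mul R/cone R]_(i <- s) p i.
Proof.
move=> FF fp; elim: s => [|i s IH].
  by rewrite big_nil; under eq_fun do rewrite big_nil; exact: cvg_cst.
rewrite big_cons; under eq_fun do rewrite big_cons.
by apply: cmul_cvg IH; exact: fp.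
Qed.

Lemma word_continuous (X : topologicalType) m (n : {ffun 'I_m -> int})
    (g : X -> R * R) : continuous g ->
  continuous (fun z : {ptws 'I_m -> X} => word X m n z g).
Proof.
move=> cg z; apply: (big_cmul_cvg _ _ (nbhs z) _
  (fun i (z : {ptws 'I_m -> X}) => cpow R (g (z i)) (n i)) _ (nbhs_filter z)) => i.
apply: (cpow_cvg _ _ (nbhs z)).
apply: (cvg_comp (fun z : {ptws 'I_m -> X} => z i) g _ (cg (z i))).
exact: ptws_proj_continuous.
Qed.

Lemma CT_separates (Y : topologicalType) (y y' : Y) : tychonoff_space R Y ->
  (forall f, CT R Y f -> f y = f y') -> y = y'.
Proof.
move=> tY fy; apply/eqP/negP => /negP yy'.
have [b [cb b01 b1 b0]] := tychonoff_bump_point R Y tY y [:: y'].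
have := fy _ (CT_expiZ R Y b pi cb).
rewrite b1 b0 ?mem_head// 1?eq_sym// mulr1 mulr0 expi0 expipi => -[]; lra.
Qed.

Lemma Cp_iso_word (X Y : topologicalType) Phi Psi (y : Y) :
  tychonoff_space R X -> Cp_iso X Y Phi Psi ->
  exists m (n : {ffun 'I_m -> int}) (z : {ptws 'I_m -> X}),
    forall g, CT R X g -> Phi g y = word X m n z g.
Proof.
move=> tX iso; have [F cF] := Cp_iso_character X Y Phi Psi y iso.
have [n nP] := character_repr R X _ _ cF tX.
pose t := in_tuple (undup F).
exists (size (undup F)), [ffun i => n (tnth t i)], (tnth t) => g Cg.
rewrite (nP g Cg) big_tnth; apply: eq_bigr => i _.
by rewrite ffunE.
Qed.

End isomorphisms.

Definition usc (Z Y : topologicalType) (Gamma : Z -> set Y) : Prop :=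
  forall z V, (forall y, Gamma z y -> nbhs y V) ->
    \forall z' \near z, Gamma z' `<=` V.

(* [Y] is a countable union of continuous images of closed subspaces of finite
   powers of [X]. A continuous map defined on a closed subspace is encoded as an
   at most single-valued upper semicontinuous relation: taking [V := set0] in
   [usc] expresses that the domain is closed. *)
Definition power_image (X Y : topologicalType) : Prop :=
  exists Gamma : forall m, {ffun 'I_m -> int} -> {ptws 'I_m -> X} -> set Y,
    [/\ forall m n, usc _ _ (Gamma m n),
        forall m n z, is_subset1 (Gamma m n z) &
        forall y, exists m n z, Gamma m n z y].

Section word_relation.
Variables (R : realType) (X Y : topologicalType).
Variables (Phi : {ptws X -> (R * R)%type} -> {ptws Y -> (R * R)%type}).
Variables (Psi : {ptws Y -> (R * R)%type} -> {ptws X -> (R * R)%type}).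
Hypotheses (tX : tychonoff_space R X) (tY : tychonoff_space R Y).
Hypothesis iso : Cp_iso R X Y Phi Psi.

Definition word_rel m (n : {ffun 'I_m -> int}) (z : {ptws 'I_m -> X}) : set Y :=
  [set y | forall g, CT R X g -> Phi g y = word R X m n z g].

Lemma word_rel_single m n z : is_subset1 (word_rel m n z).
Proof.
have [_ QC _ PQ _] := iso.
move=> y y' yP y'P; apply: (CT_separates R Y) => // f Cf.
by rewrite -(PQ f Cf) yP ?y'P//; exact: QC.
Qed.

Lemma word_finite_dependence m n (z : 'I_m -> X) : exists F : seq Y,
  forall f f', CT R Y f -> CT R Y f' -> (forall y, y \in F -> f y = f' y) ->
    word R X m n z (Psi f) = word R X m n z (Psi f').
Proof.
have /choice[F FP] := fun x => Cp_iso_character R Y X Psi Phi x (Cp_iso_sym _ _ _ _ _ iso).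
exists (flatten [seq F (z i) | i <- enum 'I_m]) => f f' Cf Cf' ff'.
apply: eq_bigr => i _; rewrite (character_eq R Y _ _ (FP (z i)) f f')// => y yF.
by apply: ff'; apply/flattenP; exists (F (z i)) => //; apply: map_f; rewrite mem_enum.
Qed.

(* If [G] had no cluster point in the finite set [F], a continuous function
   equal to [-1] on [F] and to [1] on a member of [G] would exist. *)
Lemma finite_dependence_cluster (G : set_system Y) (F : seq Y)
    (chi : (Y -> R * R) -> R * R) : ProperFilter G ->
  (forall f f', CT R Y f -> CT R Y f' -> (forall y, y \in F -> f y = f' y) ->
    chi f = chi f') ->
  (forall f, CT R Y f -> f @ G --> chi f) ->
  exists2 y, cluster G y & forall f, CT R Y f -> f y = chi f.
Proof.
move=> PG chiF chiG.
have hRR : hausdorff_space (R * R)%type by exact: (@norm_hausdorff R (R * R)%type).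
suff [y _ Gy] : exists2 y, y \in F & cluster G y.
  exists y => // f Cf; apply: hRR => A B Ay Bc.
  have [t [tA tB]] := Gy _ _ (chiG f Cf B Bc) (Cf.1 y _ Ay).
  by exists (f t).
apply: contrapT => noy.
have [A GA FA] : exists2 A, G A & forall y, y \in F -> nbhs y (~` A).
  have : forall y, y \in F -> ~ cluster G y by move=> y yF Gy; apply: noy; exists y.
  elim: {chiF noy} F => [|y F IH] Fn; first by exists setT => //; exact: filterT.
  have [|A GA FA] := IH; first by move=> y' y'F; apply: Fn; rewrite inE y'F orbT.
  have /Fn/existsNP[B /existsNP[C /not_implyP[GB /not_implyP[nC BC]]]] : y \in y :: F.
    exact: mem_head.
  exists (A `&` B); first exact: filterI.
  move=> y'; rewrite inE => /orP[/eqP->|/FA]; last by apply: filterS => t tA [].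
  by apply: filterS nC => t Ct [_ Bt]; apply: BC; exists t.
have [b [cb b01 b1 b0]] := tychonoff_bump_seq R Y tY F (~` A) FA.
have Cf := CT_expiZ R Y b pi cb.
have Cm : CT R Y (fun=> expi R pi) by apply: CT_cst; exact: circle_expi.
have : chi (fun y => expi R (pi * b y)) = cone R.
  apply: (cvg_unique hRR (chiG _ Cf)); apply: cvg_near_cst.
  by apply: filterS GA => y Ay; rewrite b0 ?mulr0 ?expi0//; apply.
have -> : chi (fun y => expi R (pi * b y)) = chi (fun=> expi R pi).
  by apply: chiF => // y yF; rewrite b1// mulr1.
have -> : chi (fun=> expi R pi) = expi R pi.
  by apply: (cvg_unique hRR (chiG _ Cm)); exact: cvg_cst.
by rewrite expipi => -[]; lra.
Qed.

Lemma word_rel_usc m n : usc _ _ (word_rel m n).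
Proof.
have [PC QC QP PQ _] := iso.
move=> z V zV; apply: contrapT => nV.
pose B (A : set {ptws 'I_m -> X}) :=
  [set y | exists z', [/\ A z', word_rel m n z' y & ~ V y]].
have PG : ProperFilter (filter_from (nbhs z) B).
  apply: filter_from_proper.
    apply: filter_from_filter; first by exists setT; exact: filterT.
    move=> A A' nA nA'; exists (A `&` A'); first exact: filterI.
    by move=> y [z' [[Az A'z] zy Vy]]; split; exists z'.
  move=> A nA; apply: contrapT => BA; apply: nV; apply: filterS nA => z' Az' y zy.
  by apply: contrapT => Vy; apply: BA; exists y, z'.
have [F FP] := word_finite_dependence m n z.
have [f Cf W Wz|y Gy yP] := finite_dependence_cluster _ F _ PG FP.
  exists [set z' | W (word R X m n z' (Psi f))].
    exact: (word_continuous R X m n (Psi f) (QC _ Cf).1 z).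
  by move=> y [z' [Wz' zy _]] /=; rewrite -(PQ f Cf) zy//; exact: QC.
have /zV nVy : word_rel m n z y.
  by move=> g Cg; rewrite yP ?QP//; exact: PC.
have GV : filter_from (nbhs z) B (~` V).
  by exists setT; [exact: filterT|move=> y' [z' []]].
by have [t []] := Gy _ _ GV nVy.
Qed.

Lemma Cp_iso_power_image : power_image X Y.
Proof.
exists word_rel; split; [exact: word_rel_usc|exact: word_rel_single|].
move=> y; have [m [n [z zP]]] := Cp_iso_word R X Y Phi Psi y tX iso.
by exists m, n, z.
Qed.

End word_relation.

(** * Properties transferred by [power_image] *)

Lemma card_le_fun (T U : Type) (A : set T) (B : set U) (u : U) :
  (A #<= B)%card -> exists f : T -> U, (forall x, A x -> B (f x)) /\ set_inj A f.
Proof.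
move=> /card_leP/unsquash g.
exists (fun x => if pselect (A x) is left Ax then val (g (SigSub (mem_set Ax))) else u).
split => x.
  by move=> Ax; case: pselect => // Ax'; exact: set_valP.
move=> y; rewrite !inE => Ax Ay; case: pselect => // Ax'; case: pselect => // Ay'.
move=> /val_inj E; have := @inj _ _ _ g _ _ _ _ E; rewrite !inE => /(_ I I).
by move=> /(congr1 val).
Qed.

Lemma card_le_setT (T U : Type) (A : set T) (f : T -> U) :
  set_inj A f -> (A #<= [set: U])%card.
Proof.
move=> fI; apply/card_leP/injfunPex.
exists (fun a : A => SigSub (mem_set (I : [set: U] (f (val a)))) : [set: U]) => //.
move=> a b _ _ /(congr1 val) /= fab; apply: val_inj; apply: fI fab; exact: valP.
Qed.

Lemma card_nat_prod (K : Type) :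
  infinite_set [set: K] -> exists h : nat * K -> K, injective h.
Proof.
move=> infK.
pose P : set (set (nat -> K)) := [set A : set (nat -> K) |
  (forall phi : nat -> K, A phi -> injective phi) /\
  (forall (phi psi : nat -> K) m n, A phi -> A psi -> phi m = psi n -> phi = psi)].
have [|A [[Ainj Adisj] Amax]] := @Zorn_bigcup (nat -> K) P.
  move=> F FP Ftot; split; first by move=> phi [A FA Aphi]; exact: (FP A FA).1.
  move=> phi psi m n [A FA Aphi] [B FB Bpsi].
  by have [AB|BA] := Ftot A B FA FB; [apply: (FP B FB).2 => //; exact: AB
    |apply: (FP A FA).2 => //; exact: BA].
pose L := [set k | forall phi n, A phi -> phi n <> k].
have finL : finite_set L.
  have [k0 _] := infinite_setN0 infK.
  apply: contrapT => /infiniteP/(card_le_fun _ _ _ _ k0)[psi [psiL psiI]].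
  have psiinj : injective psi by move=> m n; apply: psiI; rewrite inE.
  apply: (Amax (A `|` [set psi])).
    split; first by move=> phi Aphi; left.
    move=> /(_ psi (or_intror erefl)) Apsi.
    by have /(_ psi 0%N Apsi) := psiL 0%N I.
  split; first by move=> phi [/Ainj|->].
  move=> phi phi' m n [Aphi|->] [Aphi'|->] // E; first exact: Adisj E.
    by have /(_ phi m Aphi) := psiL n I.
  by have /(_ phi' n Aphi') := psiL m I; rewrite -E.
have [phi0 A0] : A !=set0.
  apply: contrapT => A0; apply: infK; apply: sub_finite_set finL => k _ phi n Aphi.
  by case: A0; exists phi.
have /countable_injP[e eI] := finite_set_countable finL.
have /choice[g gP] : forall k, exists g : (nat -> K) * nat * bool, A g.1.1 /\
    if g.2 then g.1.1 g.1.2 = k else L k /\ g.1.2 = e k.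
  move=> k; have [[phi [n [Aphi E]]]|nk] := pselect (exists phi n, A phi /\ phi n = k).
    by exists (phi, n, true).
  exists (phi0, e k, false); split => //; split => // phi n Aphi E.
  by apply: nk; exists phi, n.
exists (fun jk => (g jk.2).1.1 (pickle ((g jk.2).2, jk.1, (g jk.2).1.2))).
move=> [j k] [j' k'] /=; have [Ag gk] := gP k; have [Ag' gk'] := gP k'.
move=> E; have Ephi := Adisj _ _ _ _ Ag Ag' E; move: E; rewrite Ephi.
move=> /(Ainj _ Ag')/(pcan_inj pickleK)[Eb -> En]; congr pair.
move: gk gk'; rewrite Eb Ephi En; case: (g k').2 => [<- //|[Lk ek] [Lk' ek']].
by apply: eI; rewrite ?inE// -ek -ek'.
Qed.

Lemma card_bigcup_countType (K T : Type) (I : countType) (V : I -> set T) :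
  infinite_set [set: K] -> (forall i, V i #<= [set: K])%card ->
  (\bigcup_i V i #<= [set: K])%card.
Proof.
move=> infK VK; have [h hI] := card_nat_prod K infK.
have [k0 _] := infinite_setN0 infK.
have /choice[f fI] : forall i, exists f : T -> K, set_inj (V i) f.
  by move=> i; have [f [_ ?]] := card_le_fun _ _ _ _ k0 (VK i); exists f.
have [[i0 _]|nI] := pselect (exists i : I, True); last first.
  by apply: (card_le_setT _ _ _ (fun=> k0)) => x y; rewrite inE => -[i]; case: nI; exists i.
have /choice[g gP] : forall x, exists i, (\bigcup_i V i) x -> V i x.
  move=> x; have [[i _ Vx]|nx] := pselect ((\bigcup_i V i) x); first by exists i.
  by exists i0 => /nx.
have := card_le_setT T K (\bigcup_i V i) (fun x => h (pickle (g x), f (g x) x)).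
apply => x y; rewrite !inE => /gP Vx /gP Vy /hI[/(pcan_inj pickleK) E].
by rewrite E in Vx *; apply: fI; rewrite inE.
Qed.

Lemma usc_compact (Z Y : topologicalType) (Gamma : Z -> set Y) (C : set Z) :
  usc Z Y Gamma -> (forall z, is_subset1 (Gamma z)) -> compact C ->
  compact (\bigcup_(z in C) Gamma z).
Proof.
move=> uG sG cC F PF FC.
pose B A := [set z | C z /\ Gamma z `&` A !=set0].
have PB : ProperFilter (filter_from F B).
  apply: filter_from_proper.
    apply: filter_from_filter; first by exists setT; exact: filterT.
    move=> A A' FA FA'; exists (A `&` A'); first exact: filterI.
    by move=> z [Cz [y [zy [Ay A'y]]]]; split; split=> //; exists y.
  move=> A FA; have [y [[z Cz zy] Ay]] := filter_ex (filterI FC FA).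
  by exists z; split=> //; exists y.
have BC : filter_from F B C by exists setT; [exact: filterT|move=> z []].
have [z [Cz Fz]] := cC _ PB BC.
apply: contrapT => nF.
have [A FA zA] : exists2 A, F A & forall y, Gamma z y -> nbhs y (~` A).
  have [[y zy]|z0] := pselect (Gamma z !=set0); last first.
    by exists setT; [exact: filterT|move=> y zy; case: z0; exists y].
  have : ~ cluster F y by move=> Fy; apply: nF; exists y; split=> //; exists z.
  move=> /existsNP[A /existsNP[D /not_implyP[FA /not_implyP[nD AD]]]].
  exists A => // y' /(sG z y y' zy) <-; apply: filterS nD => t Dt At.
  by apply: AD; exists t.
have FBA : filter_from F B (B A) by exists A.
have [z' [[_ [y [zy Ay]]] /(_ y zy)]] := Fz _ _ FBA (uG z _ zA).
by apply.
Qed.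

Definition box_image (X Y : topologicalType) m (Gamma : {ptws 'I_m -> X} -> set Y)
    (A : 'I_m -> set X) : set Y :=
  \bigcup_(z in [set z : {ptws 'I_m -> X} | forall i, A i (z i)]) Gamma z.

Lemma box_image_compact (X Y : topologicalType) m
    (Gamma : {ptws 'I_m -> X} -> set Y) (A : 'I_m -> set X) :
  usc _ _ Gamma -> (forall z, is_subset1 (Gamma z)) ->
  (forall i, compact (A i)) -> compact (box_image X Y m Gamma A).
Proof.
move=> uG sG cA; apply: usc_compact => //.
exact: (@tychonoff 'I_m (fun=> X) A).
Qed.

Definition box_index := {m : nat & ({ffun 'I_m -> int} * {ffun 'I_m -> nat})%type}.

Definition box_network (X Y : topologicalType)
    (Gamma : forall m, {ffun 'I_m -> int} -> {ptws 'I_m -> X} -> set Y)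
    (N : nat -> set X) (k : nat) : set Y :=
  if @unpickle box_index k is Some (existT m ns) then
    box_image X Y m (Gamma m ns.1) (fun i => N (ns.2 i))
  else set0.

Lemma sigma_compact_power_image (X Y : topologicalType) :
  power_image X Y -> sigma_compact X -> sigma_compact Y.
Proof.
move=> [Gamma [uG sG cG]] [K [cK KT]]; exists (box_network X Y Gamma K); split.
  move=> k; rewrite /box_network; case: unpickle => [[m [n s]]|]; last exact: compact0.
  exact: box_image_compact.
apply/seteqP; split => // y _; have [m [n [z zy]]] := cG y.
have /choice[s sP] : forall i, exists k, K k (z i).
  by move=> i; have : [set: X] (z i) by []; rewrite -KT => -[k _ Kz]; exists k.
exists (pickle (existT _ m (n, [ffun i => s i]) : box_index)) => //.
by rewrite /box_network pickleK /=; exists z => // i; rewrite ffunE; exact: sP.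
Qed.

Lemma compact_nbhs_cluster (T : topologicalType) (C : set T) (F : set_system T) :
  compact C -> ProperFilter F -> (forall U, open U -> C `<=` U -> F U) ->
  exists2 c, C c & cluster F c.
Proof.
move=> cC PF FC; pose B A := C `&` closure A.
have PB : ProperFilter (filter_from F B).
  apply: filter_from_proper.
    apply: filter_from_filter; first by exists setT; exact: filterT.
    move=> A A' FA FA'; exists (A `&` A'); first exact: filterI.
    by move=> z [Cz zA]; split; split=> //; apply: closureS zA => t [].
  move=> A FA; apply: contrapT => nB.
  have /FC : open (~` closure A) by rewrite openC; exact: closed_closure.
  case/(_ _)/(filterI FA)/filter_ex.
    by move=> c Cc Ac; apply: nB; exists c.
  by move=> t [At]; apply; exact: subset_closure.
have BC : filter_from F B C by exists setT; [exact: filterT|move=> z []].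
have [c [Cc Fc]] := cC _ PB BC.
exists c => // A D FA; rewrite nbhsE => -[D' [oD' D'c] D'D].
have FBA : filter_from F B (B A) by exists A.
have [t [[Ct At] D't]] := Fc _ _ FBA (open_nbhs_nbhs (conj oD' D'c)).
have [s [As D's]] := At _ (open_nbhs_nbhs (conj oD' D't)).
by exists s; split=> //; exact: D'D.
Qed.

Lemma compact_box_nbhs (X : topologicalType) m (C : 'I_m -> set X)
    (W : set {ptws 'I_m -> X}) : (forall i, compact (C i)) ->
  (forall z : {ptws 'I_m -> X}, (forall i, C i (z i)) -> nbhs z W) ->
  exists2 U : 'I_m -> set X, (forall i, open (U i) /\ C i `<=` U i) &
    forall z : {ptws 'I_m -> X}, (forall i, U i (z i)) -> W z.
Proof.
move=> cC CW; apply: contrapT => nU.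
pose D := [set U : 'I_m -> set X | forall i, open (U i) /\ C i `<=` U i].
pose B (U : 'I_m -> set X) := [set z : {ptws 'I_m -> X} | (forall i, U i (z i)) /\ ~ W z].
have PB : ProperFilter (filter_from D B).
  apply: filter_from_proper.
    apply: filter_from_filter; first by exists (fun=> setT) => i; split=> //; exact: openT.
    move=> U U' DU DU'; exists (fun i => U i `&` U' i).
      move=> i; have [oU CU] := DU i; have [oU' CU'] := DU' i.
      by split; [exact: openI|move=> x Cx; split; [exact: CU|exact: CU']].
    by move=> z [zU Wz]; split; split=> // i; case: (zU i).
  move=> U DU; apply: contrapT => BU; apply: nU; exists U => // z zU.
  by apply: contrapT => Wz; apply: BU; exists z.
have [G [GU BG]] := ultraFilterLemma PB.
have /choice[z zP] : forall i, exists c, C i c /\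
    (fun z : {ptws 'I_m -> X} => z i) @ G --> c.
  move=> i; have [|c Cc Gc] := compact_nbhs_cluster X (C i)
      ((fun z : {ptws 'I_m -> X} => z i) @ G) (cC i) _.
    move=> U oU CU; apply: BG; exists (fun j => if j == i then U else setT).
      by move=> j; case: eqVneq => [->|_]; split => //; exact: openT.
    by move=> t [/(_ i)]; rewrite eqxx.
  exists c; split=> // V Vc.
  have [//|GV] := in_ultra_setVsetC ((fun z : {ptws 'I_m -> X} => z i) @^-1` V) GU.
  by have [x [nVx]] := Gc (~` V) V GV Vc.
have Gz : G --> (z : {ptws 'I_m -> X}) by apply: ptws_cvg => i; exact: (zP i).2.
have GW : G W by apply: Gz; apply: CW => i; exact: (zP i).1.
have GnW : G (~` W).
  apply: BG; exists (fun=> setT); first by move=> i; split=> //; exact: openT.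
  by move=> t [].
by have [t []] := filter_ex (filterI GW GnW).
Qed.

Lemma lindelof_sigma_power_image (X Y : topologicalType) :
  power_image X Y -> lindelof_sigma X -> lindelof_sigma Y.
Proof.
move=> [Gamma [uG sG cG]] [N [C [cC CT NP]]].
exists (box_network X Y Gamma N), [set D | exists m (n : {ffun 'I_m -> int})
  (c : 'I_m -> set X), (forall i, C (c i)) /\ D = box_image X Y m (Gamma m n) c].
split.
- move=> _ [m [n [c [Cc ->]]]]; apply: box_image_compact => // i; exact: cC.
- apply/seteqP; split => // y _; have [m [n [z zy]]] := cG y.
  have /choice[c cP] : forall i, exists c, C c /\ c (z i).
    by move=> i; have : [set: X] (z i) by []; rewrite -CT => -[c Cc cz]; exists c.
  exists (box_image X Y m (Gamma m n) c).
    by exists m, n, c; split => // i; case: (cP i).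
  by exists z => // i; case: (cP i).
- move=> _ U [m [n [c [Cc ->]]]] oU cU.
  have [|i|V VP VW] := compact_box_nbhs X m c [set z | Gamma m n z `<=` U].
  + by move=> i; exact: cC.
  + move=> ci; apply: uG => y zy; apply: open_nbhs_nbhs; split => //.
    by apply: cU; exists i.
  have /choice[s sP] : forall i, exists k, c i `<=` N k /\ N k `<=` V i.
    by move=> i; have [oV cV] := VP i; exact: NP.
  exists (pickle (existT _ m (n, [ffun i => s i]) : box_index)).
  rewrite /box_network pickleK /=; split => y [z zc zy].
    by exists z => // i; rewrite ffunE; apply: (sP i).1; exact: zc.
  by apply: (VW z) => // i; apply: (sP i).2; have := zc i; rewrite ffunE.
Qed.

Lemma lindelof_usc (Z Y : topologicalType) (K : Type) (Gamma : Z -> set Y)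
    (U : set (set Y)) :
  usc Z Y Gamma -> (forall z, is_subset1 (Gamma z)) -> lindelof_le Z K ->
  (forall A, U A -> open A) -> \bigcup_(A in U) A = setT ->
  exists V : set (set Y), [/\ V `<=` U, (V #<= [set: K])%card &
    \bigcup_z Gamma z `<=` \bigcup_(A in V) A].
Proof.
move=> uG sG lZ oU UT.
pose good (W : set Z) (A : set Y) := forall z, W z -> Gamma z `<=` A.
pose UZ := [set W : set Z | open W /\ ((exists2 A, U A & good W A) \/ good W set0)].
have [||UZ' [UZ'U UZ'K UZ'T]] := lZ UZ; first by move=> W [].
  apply/seteqP; split => // z _.
  have nz (A : set Y) : (forall y, Gamma z y -> nbhs y A) ->
      exists2 W, open W /\ good W A & W z.
    move=> zA; exists (interior [set z' | Gamma z' `<=` A]); last exact: uG.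
    by split; [exact: open_interior|move=> z' /interior_subset].
  have [[y zy]|z0] := pselect (Gamma z !=set0).
    have : [set: Y] y by []; rewrite -UT => -[A UA Ay].
    have [|W [oW WA] Wz] := nz A.
      by move=> y' /(sG z y y' zy) <-; apply: open_nbhs_nbhs; split => //; exact: oU.
    by exists W => //; split => //; left; exists A.
  have [|W [oW W0] Wz] := nz set0; first by move=> y zy; case: z0; exists y.
  by exists W => //; split => //; right.
have /choice[a aP] : forall W, exists A, (exists2 A, U A & good W A) -> U A /\ good W A.
  move=> W; have [[A UA WA]|nW] := pselect (exists2 A, U A & good W A).
    by exists A.
  by exists set0 => /nW.
exists (a @` (UZ' `&` [set W | exists2 A, U A & good W A])); split.
- by move=> _ [W [_ /aP[UA _]] <-].
- apply: card_le_trans UZ'K; apply: card_le_trans (card_image_le _ _) _.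
  by apply: subset_card_le => W [].
- move=> y [z _ zy]; have : [set: Z] z by []; rewrite -UZ'T => -[W UW Wz].
  have [_ [WA|W0]] := UZ'U _ UW; last by have := W0 z Wz y zy.
  by exists (a W); [exists W|exact: (aP W WA).2 z Wz y zy].
Qed.

Lemma lindelof_surj (Z Z' : topologicalType) (K : Type) (g : Z -> Z') :
  continuous g -> (forall z', exists z, g z = z') ->
  lindelof_le Z K -> lindelof_le Z' K.
Proof.
move=> cg sg lZ U oU UT.
have [||V [VU VK VT]] := lindelof_usc Z Z' K (fun z => [set g z]) U _ _ lZ oU UT.
- move=> z W gW; have Wgz : nbhs (g z) W by exact: gW.
  have Wz : nbhs z (g @^-1` W) := cg z W Wgz.
  by apply: filterS Wz => t Wt y ->.
- by move=> z y y' -> ->.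
exists V; split => //; apply/seteqP; split => // z' _; apply: VT.
by have [z <-] := sg z'; exists z.
Qed.

Lemma lindelof_finType (X : topologicalType) (K : Type) (I : finType) :
  lstar_le X K -> lindelof_le {ptws I -> X} K.
Proof.
move=> lX.
pose g (z : {ptws 'I_#|I| -> X}) : {ptws I -> X} := fun i => z (enum_rank i).
apply: (lindelof_surj _ _ _ g _ _ (lX #|I|)).
  by apply: continuous_ptws => i; exact: ptws_proj_continuous.
move=> z; exists (fun j => z (enum_val j)); apply/funext => i.
by rewrite /g enum_rankK.
Qed.

Lemma lstar_power_image (X Y : topologicalType) (K : Type) :
  infinite_set [set: K] -> power_image X Y -> lstar_le X K -> lstar_le Y K.
Proof.
move=> infK [Gamma [uG sG cG]] lX n U oU UT.
pose J := {m : nat & {ffun 'I_m -> int}}.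
pose I (k : {ffun 'I_n -> J}) := {i : 'I_n & 'I_(tag (k i))}.
pose pr (k : {ffun 'I_n -> J}) (z : {ptws I k -> X}) (i : 'I_n) :
  {ptws 'I_(tag (k i)) -> X} := fun j => z (Tagged (fun i => 'I_(tag (k i))) j).
have pr_cont k i : continuous (fun z => pr k z i).
  by apply: continuous_ptws => j; exact: ptws_proj_continuous.
pose G (k : {ffun 'I_n -> J}) (z : {ptws I k -> X}) : set {ptws 'I_n -> Y} :=
  [set y | forall i, Gamma _ (tagged (k i)) (pr k z i) (y i)].
have uGk k : usc _ _ (G k).
  move=> z V zV.
  have near_i (W : 'I_n -> set Y) i :
      (forall y, Gamma _ (tagged (k i)) (pr k z i) y -> nbhs y (W i)) ->
      \forall z' \near z, Gamma _ (tagged (k i)) (pr k z' i) `<=` W i.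
    by move=> zW; exact: (pr_cont k i z _ (uG _ _ _ _ zW)).
  have [all|] := pselect (forall i, Gamma _ (tagged (k i)) (pr k z i) !=set0).
    have /choice[y zy] := all.
    have /ptws_nbhs_box[W yW WV] : nbhs (y : {ptws 'I_n -> Y}) V by exact: zV.
    have : \forall z' \near z, forall i, Gamma _ (tagged (k i)) (pr k z' i) `<=` W i.
      apply: (@filter_forall _ _ (fun i z' =>
        Gamma _ (tagged (k i)) (pr k z' i) `<=` W i) _ (nbhs_filter z)) => i.
      by apply: near_i => y' zy'; rewrite -(sG _ _ _ _ _ (zy i) zy').
    by apply: filterS => z' z'W y' z'y'; apply: WV => i; exact/z'W/z'y'.
  move=> /existsNP[i zi]; apply: filterS (near_i (fun=> set0) i _).
    by move=> z' z'0 y z'y; have := z'0 _ (z'y i).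
  by move=> y zy; case: zi; exists y.
have sGk k z : is_subset1 (G k z).
  move=> y y' zy zy'; apply/funext => i; exact: sG (zy i) (zy' i).
have /choice[V VP] := fun k => lindelof_usc _ _ K (G k) U (uGk k) (sGk k)
  (lindelof_finType X K (I k) lX) oU UT.
exists (\bigcup_k V k); split.
- by move=> A [k _]; have [VU _ _] := VP k; exact: VU.
- by apply: card_bigcup_countType => // k; have [] := VP k.
apply/seteqP; split => // y _.
have /choice[k kP] : forall i, exists k : J, exists z, Gamma _ (tagged k) z (y i).
  by move=> i; have [m [e [z zy]]] := cG (y i); exists (existT _ m e), z.
have ex : forall i, exists z, Gamma _ (tagged (finfun k i)) z (y i).
  by move=> i; rewrite ffunE; exact: kP.
pose z i := sval (cid (ex i)).
have [_ _ VT] := VP (finfun k).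
have [|A VA Ay] := VT y; last by exists A => //; exists (finfun k).
exists (fun ij : I (finfun k) => z (tag ij) (tagged ij)) => // i.
exact: (svalP (cid (ex i))).
Qed.

(** * Pseudocompactness and compactness *)

Section weighted_sup.
Variable R : realType.
Implicit Types (v : nat -> R) (e : R).

Definition wterm v n : R := Num.min 1 `|v n| / n.+1%:R.

Definition wsup v : R := sup (range (wterm v)).

Lemma wterm_ge0 v n : 0 <= wterm v n.
Proof. by rewrite divr_ge0// le_min ler01 normr_ge0. Qed.

Lemma wterm_le v n : wterm v n <= n.+1%:R^-1.
Proof. by rewrite ler_pdivrMr// mulVf ?pnatr_eq0// ge_min lexx. Qed.

Lemma wterm_le_norm v n : wterm v n <= `|v n|.
Proof.
rewrite ler_pdivrMr// ge_min; apply/orP; right.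
by rewrite ler_peMr// ler1n.
Qed.

Lemma wterm_le1 v n : wterm v n <= 1.
Proof. by apply: le_trans (wterm_le v n) _; rewrite invf_le1// ler1n. Qed.

Lemma wsup_ub v n : wterm v n <= wsup v.
Proof.
apply: ub_le_sup; last by exists n.
by exists 1 => _ [k _ <-]; exact: wterm_le1.
Qed.

Lemma wsup_le v e : (forall n, wterm v n <= e) -> wsup v <= e.
Proof.
move=> ve; apply: ge_sup; first by exists (wterm v 0); exists 0%N.
by move=> _ [k _ <-].
Qed.

Lemma wsup_ge0 v : 0 <= wsup v.
Proof. exact: le_trans (wterm_ge0 v 0) (wsup_ub v 0). Qed.

Lemma wsup_gt0 v n : v n != 0 -> 0 < wsup v.
Proof.
move=> vn; apply: lt_le_trans (wsup_ub v n).
by rewrite divr_gt0// lt_min ltr01 normr_gt0.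
Qed.

Lemma wsup_lt v e n : e <= 1 -> wsup v < e / n.+1%:R -> `|v n| < e.
Proof.
move=> e1 ve; have := le_lt_trans (wsup_ub v n) ve.
rewrite ltr_pM2r ?invr_gt0// gt_min => /orP[|//].
by rewrite ltNge e1.
Qed.

Lemma wsup_small e : 0 < e -> exists N, forall v,
  (forall n, (n < N)%N -> `|v n| <= e) -> wsup v <= e.
Proof.
move=> e0; exists (Num.trunc e^-1).+1 => v vN; apply: wsup_le => n.
have [nN|Nn] := ltnP n (Num.trunc e^-1).+1.
  exact: le_trans (wterm_le_norm v n) (vN n nN).
apply: le_trans (wterm_le v n) _; rewrite -[leRHS]invrK lef_pV2 ?posrE ?invr_gt0//.
apply: ltW; apply: lt_le_trans (truncnS_gt _) _.
by rewrite ler_nat; exact: leqW.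
Qed.

Lemma wterm_triangle v v' v'' n : `|v n| <= `|v' n| + `|v'' n| ->
  wterm v n <= wterm v' n + wterm v'' n.
Proof.
move=> vn; rewrite -mulrDl ler_pM2r ?invr_gt0// /Num.min.
have := normr_ge0 (v' n); have := normr_ge0 (v'' n).
by do !case: ltP => ?; lra.
Qed.

Lemma wsup_triangle v v' v'' : (forall n, `|v n| <= `|v' n| + `|v'' n|) ->
  wsup v <= wsup v' + wsup v''.
Proof.
move=> vn; apply: wsup_le => n; apply: le_trans (wterm_triangle _ _ _ _ (vn n)) _.
by apply: lerD; exact: wsup_ub.
Qed.

Lemma wsup_continuous (T : topologicalType) (v : T -> nat -> R) :
  (forall n, continuous (fun t => v t n)) -> continuous (fun t => wsup (v t)).
Proof.
move=> cv t; apply/cvgrPdist_le => e e0.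
have [N NP] := wsup_small e e0.
have : \forall t' \near t, forall i : 'I_N, `|v t i - v t' i| <= e.
  apply: (@filter_forall _ _ (fun (i : 'I_N) t' => `|v t i - v t' i| <= e) _
    (nbhs_filter t)) => i.
  have /cvgrPdist_le := cv i t; exact.
apply: filterS => t' tt'.
have small : wsup (fun n => v t n - v t' n) <= e.
  by apply: NP => n nN; exact: (tt' (Ordinal nN)).
have small' : wsup (fun n => v t' n - v t n) <= e.
  by apply: NP => n nN; rewrite distrC; exact: (tt' (Ordinal nN)).
have h1 : wsup (v t) <= wsup (v t') + wsup (fun n => v t n - v t' n).
  by apply: wsup_triangle => n; rewrite -[X in `|X| <= _](subrKC (v t' n)) ler_normD.
have h2 : wsup (v t') <= wsup (v t) + wsup (fun n => v t' n - v t n).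
  by apply: wsup_triangle => n; rewrite -[X in `|X| <= _](subrKC (v t n)) ler_normD.
rewrite ler_norml; lra.
Qed.

End weighted_sup.

Lemma norm_sub_cvg (R : realType) (T : Type) (F : set_system T) (f : T -> R * R)
    (p q : R * R) : Filter F ->
  f @ F --> p -> (fun t => `|f t - q|) @ F --> `|p - q|.
Proof.
move=> FF fp; have fq : (fun t => f t - q) @ F --> p - q.
  by apply: (@cvgB R (R * R)%type) => //; exact: cvg_cst.
exact: cvg_norm fq.
Qed.

Section pseudocompact_spaces.
Variables (R : realType) (X : topologicalType).
Hypothesis pX : pseudocompact R X.

Lemma pseudocompact_pos (u : X -> R) : continuous u -> (forall x, 0 < u x) ->
  exists2 d, 0 < d & forall x, d <= u x.
Proof.
move=> cu u0; have [x|M uM] := pX (fun x => (u x)^-1).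
  by apply: cvgV; [rewrite gt_eqF|exact: cu].
exists (Num.max 1 M)^-1; first by rewrite invr_gt0 lt_max ltr01.
move=> x; rewrite -[leRHS]invrK lef_pV2 ?posrE ?invr_gt0// ?lt_max ?ltr01//.
have := uM x; rewrite ger0_norm ?invr_ge0 ?(ltW (u0 x))// => uxM.
by rewrite le_max uxM orbT.
Qed.

(** A filter without cluster points yields, on each compact piece, a function
    that is positive there and vanishes on a member of the filter. *)
Lemma sigma_compact_pseudocompact : tychonoff_space R X -> sigma_compact X ->
  compact [set: X].
Proof.
move=> tX [K [cK KT]] F PF _; apply: contrapT => nF.
pose good (b : X -> R) := [/\ continuous b, forall x, 0 <= b x <= 1 &
  F [set x | b x = 0]].
have goodU b c : good b -> good c -> good (fun z => 1 - (1 - b z) * (1 - c z)).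
  move=> [cb b01 Fb] [cc c01 Fc]; split.
  - move=> z; apply: cvgB; first exact: cvg_cst.
    by apply: cvgM; (apply: cvgB; [exact: cvg_cst|]); [exact: cb|exact: cc].
  - move=> z; have /andP[b0 b1] := b01 z; have /andP[c0 c1] := c01 z.
    have : 0 <= (1 - b z) * (1 - c z) by apply: mulr_ge0; lra.
    have : (1 - b z) * (1 - c z) <= 1 by apply: mulr_ile1; lra.
    by lra.
  - by apply: filterS (filterI Fb Fc) => z [/= -> ->]; rewrite !subr0 mulr1 subrr.
have good0 : good (fun=> 0).
  split; [exact: cst_continuous|by move=> z; rewrite lexx ler01|].
  by apply: filterS filterT.
have /choice[b bP] : forall n, exists b, good b /\ forall x, K n x -> 0 < b x.
  move=> n; apply: contrapT => nb.
  pose B (b : X -> R) := K n `&` [set x | b x = 0].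
  have PB : ProperFilter (filter_from good B).
    apply: filter_from_proper.
      apply: filter_from_filter; first by exists (fun=> 0).
      move=> b c gb gc; exists (fun z => 1 - (1 - b z) * (1 - c z)); first exact: goodU.
      have [_ b01 _] := gb; have [_ c01 _] := gc.
      move=> z [Kz /= bcz]; have /andP[b0 b1] := b01 z; have /andP[c0 c1] := c01 z.
      have bz : (1 - b z) * (1 - c z) = 1 by lra.
      have [b2 b3] : 0 <= 1 - b z /\ 1 - b z <= 1 by split; lra.
      have [c2 c3] : 0 <= 1 - c z /\ 1 - c z <= 1 by split; lra.
      have bz' : (1 - b z) * (1 - c z) <= 1 - b z by rewrite ler_piMr.
      have cz' : (1 - b z) * (1 - c z) <= 1 - c z by rewrite ler_piMl.
      by split; (split; [exact: Kz|rewrite /=; lra]).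
    move=> b gb; apply: contrapT => Bb; apply: nb; exists b; split => // x Kx.
    have [_ /(_ x)/andP[b0 _] _] := gb; rewrite lt_neqAle b0 andbT.
    by apply/eqP => bx; apply: Bb; exists x.
  have BK : filter_from good B (K n) by exists (fun=> 0) => // x [].
  have [x [Kx Bx]] := cK n _ PB BK.
  have : ~ cluster F x by move=> Fx; apply: nF; exists x.
  move=> /existsNP[A /existsNP[D /not_implyP[FA /not_implyP[nD AD]]]].
  have [b [cb b01 bx bD]] := tychonoff_bump R X tX x D nD.
  have gb : good b.
    split => //; apply: filterS FA => z Az; apply: bD => Dz.
    by apply: AD; exists z.
  have FB : filter_from good B (B b) by exists b.
  have nb0 : nbhs x [set z | 0 < b z].
    have b0 : nbhs (b x) [set r : R | 0 < r].
      by apply: open_nbhs_nbhs; split; [exact: open_gt|rewrite /= bx].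
    exact: (cb x _ b0).
  have [z [[_ /= bz]]] := Bx _ _ FB nb0.
  by rewrite bz ltxx.
have [|x|d d0 dP] := pseudocompact_pos (fun x => wsup R (fun n => b n x)).
- by apply: wsup_continuous => n; have [[]] := bP n.
- have : [set: X] x by []; rewrite -KT => -[n _ Kx].
  by apply: (wsup_gt0 _ _ n); rewrite gt_eqF//; apply: (bP n).2.
have d2 : 0 < d / 2 by rewrite divr_gt0.
have [N NP] := wsup_small R _ d2.
have : F [set x | forall i : 'I_N, b i x = 0].
  apply: (@filter_forall _ _ (fun (i : 'I_N) x => b i x = 0) F) => i.
  by have [[]] := bP i.
move=> /filter_ex[x bx]; have := dP x; apply/negP; rewrite -ltNge.
apply: (@le_lt_trans _ _ (d / 2)); last lra.
by apply: NP => n nN; rewrite (bx (Ordinal nN)) normr0 ltW.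
Qed.

Lemma pseudocompact_cluster (g : nat -> X -> R * R) (x : nat -> X) :
  (forall n, CT R X (g n)) ->
  exists c, forall N e, 0 < e -> exists2 j, (N <= j)%N &
    wsup R (fun n => `|g n (x j) - g n c|) < e.
Proof.
move=> Cg.
pose I11 : set (R * R) := `[-1, 1]%classic `*` `[-1, 1]%classic.
pose p (j : nat) : {ptws nat -> (R * R)%type} := fun n => g n (x j).
have cI : compact [set f : {ptws nat -> (R * R)%type} | forall n, I11 (f n)].
  apply: (@tychonoff nat (fun=> (R * R)%type) (fun=> I11)) => n.
  by apply: compact_setX; exact: segment_compact.
have pI : (p @ \oo) [set f : {ptws nat -> (R * R)%type} | forall n, I11 (f n)].
  exists 0%N => // j _ n; have [t _ E] := circle_lift R _ (CT_circle R X _ (x j) (Cg n)).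
  by rewrite /I11 /p E; split; rewrite /= in_itv /= ?cos_geN1 ?cos_le1 ?sin_geN1 ?sin_le1.
have [q [_ qP]] := cI _ _ pI.
have {}qP N e : 0 < e -> exists2 j, (N <= j)%N & wsup R (fun n => `|p j n - q n|) < e.
  move=> e0; have nq : nbhs q [set f | wsup R (fun n => `|f n - q n|) < e].
    have cw : continuous (fun f : {ptws nat -> (R * R)%type} =>
        wsup R (fun n => `|f n - q n|)).
      apply: wsup_continuous => n f; apply: (norm_sub_cvg _ _ (nbhs f)).
      exact: (@ptws_proj_continuous nat _ n f).
    have : nbhs (wsup R (fun n => `|q n - q n|)) [set r : R | r < e].
      apply: open_nbhs_nbhs; split; first exact: open_lt.
      apply: le_lt_trans e0; apply: wsup_le => n.
      by rewrite /wterm subrr !normr0 /Num.min ltNge ler01 /= mul0r.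
    by move=> /cw.
  have pN : (p @ \oo) [set p j | j in [set j | (N <= j)%N]].
    by exists N => // j /= Nj; exists j.
  by have [_ [[j Nj <-]] ?] := qP _ _ pN nq; exists j.
have [[c cq]|nc] := pselect (exists c, forall n, g n c = q n).
  exists c => N e e0; have [j Nj jP] := qP N e e0; exists j => //.
  by under eq_fun do rewrite cq.
have [|y|d d0 dP] := pseudocompact_pos (fun y => wsup R (fun n => `|g n y - q n|)).
- apply: wsup_continuous => n y; apply: (norm_sub_cvg _ _ (nbhs y)).
  exact: (Cg n).1 y.
- have /existsNP[n gn] : ~ forall n, g n y = q n by move=> yq; apply: nc; exists y.
  by apply: (wsup_gt0 _ _ n); rewrite normr_eq0 subr_eq0; apply/eqP.
by have [j _] := qP 0%N d d0; rewrite ltNge dP.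
Qed.

End pseudocompact_spaces.

Lemma max0_cvg (R : realType) (T : Type) (F : set_system T) (f : T -> R) (a : R) :
  Filter F -> f @ F --> a -> (fun t => Num.max 0 (f t)) @ F --> Num.max 0 a.
Proof.
move=> FF fa; have E (b : R) : Num.max 0 b = (b + `|b|) / 2.
  by rewrite maxr_absE add0r sub0r normrN.
under eq_fun do rewrite E; rewrite E; apply: cvgM; last exact: cvg_cst.
by apply: cvgD => //; exact: cvg_norm.
Qed.

Lemma sum_cvg (R : realType) (T I : Type) (F : set_system T) (s : seq I)
    (f : I -> T -> R) (a : I -> R) : Filter F -> (forall i, f i @ F --> a i) ->
  (fun t => \sum_(i <- s) f i t) @ F --> \sum_(i <- s) a i.
Proof.
move=> FF fa; elim: s => [|i s IH].
  by rewrite big_nil; under eq_fun do rewrite big_nil; exact: cvg_cst.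
rewrite big_cons; under eq_fun do rewrite big_cons.
by apply: cvgD => //; exact: fa.
Qed.

Section locally_finite_sums.
Variables (R : realType) (Y : topologicalType) (w : Y -> R) (y_ : nat -> Y).
Hypotheses (cw : continuous w) (w0 : forall y, 0 <= w y).
Hypothesis wy : forall i, i%:R <= w (y_ i).

Definition lf_bump (i : nat) (y : Y) : R := Num.max 0 (1 - `|w y - w (y_ i)|).

Definition lf_bound (y : Y) : nat := (Num.trunc (w y)).+2.

Definition lf_sum (th : nat -> R) (y : Y) : R :=
  \sum_(i < lf_bound y) th i * lf_bump i y.

Definition lf_fun (th : nat -> R) (y : Y) : R * R := expi R (lf_sum th y).

Lemma lf_bump0 i y : w y + 1 <= i%:R -> lf_bump i y = 0.
Proof.
move=> wi; apply/max_idPl; rewrite subr_le0 distrC ger0_norm; have := wy i; lra.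
Qed.

Lemma lf_bump_continuous i : continuous (lf_bump i).
Proof.
move=> y; apply: (max0_cvg _ _ (nbhs y)).
apply: cvgB; first exact: cvg_cst.
by apply: cvg_norm; apply: cvgB; [exact: cw|exact: cvg_cst].
Qed.

Lemma lf_sumE th M y : (lf_bound y <= M)%N -> lf_sum th y = \sum_(i < M) th i * lf_bump i y.
Proof.
move=> yM; rewrite /lf_sum -!(big_mkord xpredT (fun i => th i * lf_bump i y)).
rewrite (big_cat_nat _ yM)//= [X in _ = _ + X]big_nat_cond [X in _ = _ + X]big1 ?addr0//.
move=> i /andP[/andP[yi _] _]; rewrite lf_bump0 ?mulr0//.
have : (Num.trunc (w y)).+2%:R <= i%:R :> R by rewrite ler_nat.
have := truncnS_gt (w y); rewrite -!natr1; lra.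
Qed.

Lemma lf_sum_continuous th : continuous (lf_sum th).
Proof.
move=> y; pose M := (lf_bound y).+1.
have nM : \forall z \near y, lf_sum th z = \sum_(i < M) th i * lf_bump i z.
  have : nbhs (w y) [set r : R | r < w y + 1].
    by apply: open_nbhs_nbhs; split; [exact: open_lt|rewrite /= ltrDl].
  move=> wy1; have nw : nbhs y (w @^-1` [set r : R | r < w y + 1]) := cw y _ wy1.
  apply: filterS nw => z /= zy; apply: lf_sumE.
  rewrite /M /lf_bound !ltnS -ltnS truncn_lt_nat//; apply: lt_le_trans zy _.
  by rewrite -[X in _ <= X]natr1 lerD2r; apply: ltW; exact: truncnS_gt.
rewrite /continuous_at (nbhs_singleton nM).
have sc : (fun z => \sum_(i < M) th i * lf_bump i z) @ y -->
    \sum_(i < M) th i * lf_bump i y.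
  apply: (sum_cvg _ _ _ (nbhs y) _ (fun (i : 'I_M) z => th i * lf_bump i z)) => i.
  by apply: cvgM; [exact: cvg_cst|exact: lf_bump_continuous].
by move=> W /sc; apply: filterS2 nM => z /= ->.
Qed.

Lemma lf_fun_CT th : CT R Y (lf_fun th).
Proof. by apply: CT_expi; exact: lf_sum_continuous. Qed.

Lemma lf_fun_eq th th' y : (forall i, (i < lf_bound y)%N -> th i = th' i) ->
  lf_fun th y = lf_fun th' y.
Proof.
by move=> tt'; rewrite /lf_fun /lf_sum; congr expi; apply: eq_bigr => i _; rewrite tt'.
Qed.

Lemma lf_funD th th' : lf_fun (fun i => th i + th' i) = CT_mul (lf_fun th) (lf_fun th').
Proof.
apply/funext => y; rewrite /lf_fun /CT_mul -expiD; congr expi.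
by rewrite -big_split; apply: eq_bigr => i _; rewrite mulrDl.
Qed.

Lemma lf_fun_single i t : lf_fun (fun j => if j == i then t else 0) (y_ i) = expi R t.
Proof.
rewrite /lf_fun (@lf_sumE _ (maxn (lf_bound (y_ i)) i.+1)) ?leq_maxl//; congr expi.
have iM : (i < maxn (lf_bound (y_ i)) i.+1)%N by rewrite leq_max leqnn orbT.
rewrite (bigD1 (Ordinal iM))//= eqxx big1 ?addr0.
  by rewrite /lf_bump subrr normr0 subr0 (max_idPr _) ?mulr1.
by move=> j ji; case: eqP => [E|]; rewrite ?mul0r//; case/eqP: ji; apply: val_inj.
Qed.

End locally_finite_sums.

Section pseudocompact_transfer.
Variables (R : realType) (X Y : topologicalType).
Variables (Phi : {ptws X -> (R * R)%type} -> {ptws Y -> (R * R)%type}).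
Variables (Psi : {ptws Y -> (R * R)%type} -> {ptws X -> (R * R)%type}).
Hypothesis iso : Cp_iso R X Y Phi Psi.

(* If [Y] carries an unbounded function then every real sequence [th] defines a
   function [E th] on [Y], and a sequence of points [x_ i] of [X] at which
   [Psi (E (th i))] is far from [1] leads to a contradiction: a subsequence [J]
   can be chosen so that at [x_ j], [j] in [J], the function [h := Psi (E J)] is
   far from [1], although [x_ j] clusters at a point where [h] equals [1]. *)
Lemma pseudocompact_transfer : pseudocompact R X -> pseudocompact R Y.
Proof.
move=> pX f cf; apply: contrapT => nf.
have [PC QC QP PQ [Pm Pc Qc]] := iso.
pose w y := `|f y|.
have cw : continuous w by move=> y; apply: cvg_norm; exact: cf.
have w0 y : 0 <= w y by exact: normr_ge0.
have /choice[y_ wy] : forall i : nat, exists y, i%:R <= w y.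
  move=> i; apply: contrapT => ny; apply: nf; exists i%:R => y.
  by rewrite leNgt; apply/negP => /ltW iy; apply: ny; exists y.
pose A := lf_fun R Y w y_.
have CA th : CT R Y (A th) by exact: lf_fun_CT.
have AD th th' : Psi (A (fun i => th i + th' i)) = CT_mul (Psi (A th)) (Psi (A th')).
  have -> : A (fun i => th i + th' i) = CT_mul (A th) (A th') by exact: lf_funD.
  rewrite -{1}(PQ _ (CA th)) -{1}(PQ _ (CA th')) -Pm ?QP//; try exact: QC.
  by apply: CT_CT_mul; exact: QC.
have Afin x : exists N : nat, forall th th', (forall i, (i < N)%N -> th i = th' i) ->
    Psi (A th) x = Psi (A th') x.
  have [F FP] := Cp_iso_character R Y X Psi Phi x (Cp_iso_sym _ _ _ _ _ iso).
  exists (\max_(y <- F) lf_bound R Y w y)%N => th th' tt'.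
  apply: (character_eq R Y _ _ FP) => // y yF; apply: lf_fun_eq => i iy.
  by apply: tt'; apply: leq_trans iy _; rewrite (big_rem y)//= leq_maxl.
have /choice[B BP] := Afin.
have A0 x : Psi (A (fun=> 0)) x = cone R.
  apply: (@cmul_inj R (Psi (A (fun=> 0)) x)).
    by apply: CT_circle; exact: QC.
  rewrite cmulp1; have := congr1 (@^~ x) (AD (fun=> 0) (fun=> 0)).
  by rewrite /CT_mul => <-; congr (Psi (A _) x); apply/funext => i; rewrite addr0.
have /choice[tx txP] : forall i : nat, exists tx : R * X,
    (Psi (A (fun j => if j == i then tx.1 else 0)) tx.2).1 <= 0.
  move=> i; pose a t := A (fun j => if j == i then t else 0).
  have aX x k : Psi (a (k%:R * pi)) x = iter k (circle_mul (Psi (a pi) x)) (cone R).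
    elim: k => [|k IH] /=.
      by rewrite -(A0 x) /a; congr (Psi (A _) x); apply/funext => j; rewrite mul0r if_same.
    rewrite -IH -[RHS]/(CT_mul (Psi (a pi)) (Psi (a (k%:R * pi))) x) -AD.
    congr (Psi (A _) x); apply/funext => j; case: eqP => _; last by rewrite addr0.
    by rewrite -natr1 mulrDl mul1r addrC.
  apply: contrapT => na.
  have a1 : Psi (a pi) = fun=> cone R.
    apply/funext => x; apply: circle_no_small_subgroups; first exact: (CT_circle R X _ x (QC _ (CA _))).
    move=> k; rewrite -aX ltNge; apply/negP => kx; apply: na.
    by exists (k%:R * pi, x).
  have a0 : Psi (A (fun=> 0)) = Psi (a pi) by rewrite a1; apply/funext => x; exact: A0.
  have := congr1 (@^~ (y_ i)) (congr1 Phi a0); rewrite /= /a !(PQ _ (CA _)).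
  rewrite /A lf_fun_single// expipi /lf_fun /lf_sum big1 ?expi0; last first.
    by move=> j _; rewrite mul0r.
  by move=> []; lra.
pose E (S : pred nat) := Psi (A (fun i => if S i then (tx i).1 else 0)).
pose x_ i := (tx i).2.
have CE S : CT R X (E S) by exact: QC.
have EB x S S' : (forall i, (i < B x)%N -> S i = S' i) -> E S x = E S' x.
  by move=> SS'; apply: BP => i ix; rewrite SS'.
have E1 x S : (forall i, (i < B x)%N -> ~~ S i) -> E S x = cone R.
  by move=> S0; rewrite -(A0 x); apply: BP => i ix; rewrite (negbTE (S0 i ix)).
have ED (i : nat) (s : seq nat) : i \notin s -> forall x,
    E (mem (i :: s)) x = circle_mul (E (mem s) x) (E (pred1 i) x).
  move=> is_ x; rewrite -[RHS]/(CT_mul (E (mem s)) (E (pred1 i)) x) -AD.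
  congr (Psi (A _) x); apply/funext => j; rewrite !inE /=.
  have [->|ji] := eqVneq j i; first by rewrite (negbTE is_) add0r.
  by rewrite addr0.
pose g (n : nat) := if @unpickle (seq nat) n is Some s then E (mem s) else E pred0.
have gE (s : seq nat) : g (pickle s) = E (mem s) by rewrite /g pickleK.
have Cg n : CT R X (g n) by rewrite /g; case: unpickle.
have [c cP] := pseudocompact_cluster R X pX g x_ Cg.
pose u x := wsup R (fun n => `|g n x - g n c|).
pose eps (s : seq nat) : R := Num.min ((size s).+1%:R^-1) (8^-1 / (pickle s).+1%:R).
have /choice[nx nxP] : forall s : seq nat, exists j,
    [/\ (B c <= j)%N, forall i, i \in s -> (i < j)%N /\ (B (x_ i) <= j)%N
      & u (x_ j) < eps s].
  move=> s; have e0 : 0 < eps s by rewrite lt_min invr_gt0 ltr0n /= divr_gt0 ?invr_gt0 ?ltr0n.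
  have [j sj uj] := cP (B c + \sum_(i <- s) (i.+1 + B (x_ i)))%N _ e0.
  exists j; split => //; first by apply: leq_trans sj; exact: leq_addr.
  move=> i is_; have ij : (i.+1 + B (x_ i) <= j)%N.
    apply: leq_trans sj; rewrite (big_rem i)//= addnCA; exact: leq_addr.
  by split; apply: leq_trans ij; [exact: leq_addr|exact: leq_addl].
pose St := fix St k := if k is k'.+1 then nx (St k') :: St k' else [::].
pose jk k := nx (St k).
have sizeSt k : size (St k) = k by elim: k => //= k ->.
have StP k i : i \in St k -> exists2 l, (l < k)%N & i = jk l.
  elim: k => // k IH; rewrite inE => /orP[/eqP->|/IH[l lk ->]]; first by exists k.
  by exists l => //; exact: ltnW.
have jkSt k l : (l < k)%N -> jk l \in St k.
  elim: k => // k IH; rewrite ltnS leq_eqVlt inE => /orP[/eqP->|/IH->].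
    by rewrite eqxx.
  by rewrite orbT.
have jk_ge l : (l <= jk l)%N.
  have inc k : (jk k < jk k.+1)%N.
    by have [_ /(_ (jk k) (mem_head _ _))[]] := nxP (St k.+1).
  by elim: l => // l IH; exact: leq_ltn_trans IH (inc l).
pose J : pred nat := fun i => `[< exists k, i = jk k >].
pose h := E J.
have Stc k : E (mem (St k)) c = cone R.
  apply: E1 => i ic; apply/negP => /= /StP[l _ il].
  by have [] := nxP (St l); rewrite -/(jk l) -il leqNgt ic.
have h1 x : (forall n, g n x = g n c) -> h x = cone R.
  move=> gx; rewrite -(Stc (B x)) -gE -gx gE; apply: EB => i ix.
  apply/idP/idP => [/asboolP[k ik]|/StP[k _ ik]]; last by apply/asboolP; exists k.
  by rewrite ik; apply: jkSt; apply: leq_ltn_trans ix; rewrite ik.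
have hj k : (h (x_ (jk k))).1 <= 8^-1.
  have -> : h (x_ (jk k)) = E (mem (St k.+1)) (x_ (jk k)).
    apply: EB => i ix; apply/idP/idP => [/asboolP[l il]|/StP[l _ il]]; last first.
      by apply/asboolP; exists l.
    rewrite il; refine (jkSt _ _ _); rewrite ltnNge; apply/negP => kl.
    have [_ /(_ (jk k) (jkSt _ _ kl))[_]] := nxP (St l).
    by rewrite leqNgt -/(jk l) -il ix.
  rewrite ED; last first.
    apply/negP => jS; have [_ /(_ _ jS)[]] := nxP (St k).
    by rewrite -/(jk k) ltnn.
  have [_ _ uk] := nxP (St k).
  have : `|g (pickle (St k)) (x_ (jk k)) - g (pickle (St k)) c| < 8^-1.
    rewrite -[X in X < _]normr_id; apply: (wsup_lt R (fun n => `|g n (x_ (jk k)) - g n c|)).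
      by rewrite invf_le1 ?ler1n.
    by apply: lt_le_trans uk _; rewrite ge_min lexx orbT.
  rewrite gE Stc; set p := E _ _; set q := E _ _ => pq.
  have q0 : q.1 <= 0.
    have -> : q = Psi (A (fun j => if j == jk k then (tx (jk k)).1 else 0)) (x_ (jk k)).
      by congr (Psi (A _) _); apply/funext => j /=; case: eqP => // ->.
    exact: txP.
  have : `|q.2| <= 1.
    have [t _ ->] := circle_lift R q (CT_circle R X _ _ (CE _)).
    exact: sin_max.
  have : `|p.2| < 8^-1.
    by apply: le_lt_trans pq; rewrite -[p.2]subr0 -/((p - cone R).2) prod_normE le_max lexx orbT.
  have : `|p.1 - 1| < 8^-1.
    by apply: le_lt_trans pq; rewrite -/((p - cone R).1) prod_normE le_max lexx.
  rewrite /circle_mul /= => p1 p2 q2.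
  have : `|p.2 * q.2| <= 8^-1.
    by rewrite normrM -[leRHS]mulr1; apply: ler_pM => //; exact: ltW.
  have : p.1 * q.1 <= 0.
    rewrite mulr_ge0_le0//; move: p1; rewrite ltr_norml; lra.
  by rewrite ler_norml; lra.
have [|x|d d0 dP] := pseudocompact_pos R X pX (fun x => u x + Num.max 0 ((h x).1 - 1 / 2)).
- move=> x; apply: cvgD.
    apply: wsup_continuous => n y; apply: (norm_sub_cvg _ _ (nbhs y)).
    exact: (Cg n).1 y.
  apply: (max0_cvg _ _ (nbhs x)); apply: cvgB; last exact: cvg_cst.
  by apply: (fst_cvg _ _ (nbhs x)); exact: (CE J).1 x.
- have [gx|/existsNP[n gn]] := pselect (forall n, g n x = g n c).
    rewrite (h1 x gx) /=; have := wsup_ge0 R (fun n => `|g n x - g n c|); rewrite -/(u x).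
    have -> : Num.max 0 (1 - 1 / 2) = 1 - 1 / 2 :> R by apply/max_idPr; lra.
    lra.
  have : 0 < u x by apply: (wsup_gt0 _ _ n); rewrite !normr_eq0 subr_eq0; apply/eqP.
  have : 0 <= Num.max 0 ((h x).1 - 1 / 2) by rewrite le_max lexx.
  lra.
pose k := Num.trunc d^-1.
have := dP (x_ (jk k)); apply/negP; rewrite -ltNge.
have -> : Num.max 0 ((h (x_ (jk k))).1 - 1 / 2) = 0.
  by apply/max_idPl; have := hj k; lra.
rewrite addr0; have [_ _ uk] := nxP (St k); apply: lt_trans uk _.
rewrite gt_min sizeSt; apply/orP; left.
by rewrite -[ltRHS]invrK ltf_pV2 ?posrE ?invr_gt0// truncnS_gt.
Qed.

End pseudocompact_transfer.

(** * Separation of points and metrizability *)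

Section separation.
Variables (R : realType) (X Y : topologicalType).
Variables (Phi : {ptws X -> (R * R)%type} -> {ptws Y -> (R * R)%type}).
Variables (Psi : {ptws Y -> (R * R)%type} -> {ptws X -> (R * R)%type}).
Hypotheses (tX : tychonoff_space R X) (tY : tychonoff_space R Y).
Hypothesis iso : Cp_iso R X Y Phi Psi.

Lemma big_cmul_extend (F S : seq X) (n : X -> int) (g : X -> R * R) :
  {subset F <= S} ->
  \big[@circle_mul R/cone R]_(x <- undup F) cpow R (g x) (n x) =
  \big[@circle_mul R/cone R]_(x <- undup S) cpow R (g x) (if x \in F then n x else 0).
Proof.
move=> FS.
rewrite (perm_big [seq x <- undup S | x \in F]) /=; last first.
  apply: uniq_perm; [exact: undup_uniq|by rewrite filter_uniq// undup_uniq|].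
  move=> x; rewrite mem_filter !mem_undup; have [/FS->|] := boolP (x \in F) => //.
by rewrite big_filter big_mkcond; apply: eq_bigr => x _; case: ifP.
Qed.

(* The coefficients of [y] and [y'] at some point [x] of [X] differ, by [m] say;
   a function that is trivial at the other relevant points and whose angle at [x]
   is [pi / m] tells [y] and [y'] apart. *)
Lemma Cp_iso_separation (y y' : Y) : y <> y' ->
  exists (x : X) (S : seq X) (m : int), m != 0 /\ forall b : X -> R, continuous b ->
    b x = 1 -> (forall z, z \in S -> z != x -> b z = 0) ->
    Phi (fun z => expi R (pi / m%:~R * b z)) y <>
    Phi (fun z => expi R (pi / m%:~R * b z)) y'.
Proof.
move=> yy'; have [PC QC QP PQ _] := iso.
have [F cF] := Cp_iso_character R X Y Phi Psi y iso.
have [F' cF'] := Cp_iso_character R X Y Phi Psi y' iso.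
have [n nP] := character_repr R X _ _ cF tX.
have [n' n'P] := character_repr R X _ _ cF' tX.
pose S := undup (F ++ F').
pose N x := if x \in F then n x else 0; pose N' x := if x \in F' then n' x else 0.
have NP g : CT R X g -> Phi g y = \big[@circle_mul R/cone R]_(x <- S) cpow R (g x) (N x).
  by move=> Cg; rewrite (nP g Cg); apply: big_cmul_extend => x xF; rewrite mem_cat xF.
have N'P g : CT R X g -> Phi g y' = \big[@circle_mul R/cone R]_(x <- S) cpow R (g x) (N' x).
  move=> Cg; rewrite (n'P g Cg); apply: big_cmul_extend => x xF.
  by rewrite mem_cat xF orbT.
have [x xS Nx] : exists2 x, x \in S & N x != N' x.
  apply: contrapT => nx; apply: yy'; apply: (CT_separates R Y) => // f Cf.
  rewrite -(PQ f Cf) NP ?N'P; try exact: QC.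
  rewrite !big_seq; apply: eq_bigr => x xS; congr cpow.
  by apply: contrapT => /eqP Nx; apply: nx; exists x.
exists x, S, (N x - N' x); split => [|b cb bx bS]; first by rewrite subr_eq0.
set g := fun z => _; have Cg : CT R X g by exact: CT_expiZ.
have gE (k : X -> int) :
    \big[@circle_mul R/cone R]_(z <- S) cpow R (g z) (k z) = cpow R (g x) (k x).
  rewrite (bigD1_seq x) ?undup_uniq//= big_seq_cond big1 ?cmulp1//.
  by move=> z /andP[zS zx]; rewrite /g bS// mulr0 expi0 cpow1.
rewrite NP// N'P// !gE /g bx mulr1 !cpow_expi => E.
have : expi R pi = cone R.
  rewrite -(cmulpV R _ (circle_expi R ((N' x)%:~R * (pi / (N x - N' x)%:~R)))).
  rewrite -{1}E -expiN -expiD -mulNr -mulrDl -intrN -intrD mulrC divfK//.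
  by rewrite intr_eq0 subr_eq0.
by rewrite expipi => -[]; lra.
Qed.

End separation.

Section metrizability.
Variable R : realType.

Lemma separating_sequence_metrizable (Y : topologicalType) (f : nat -> Y -> R * R) :
  compact [set: Y] -> (forall n, CT R Y (f n)) ->
  (forall y y', (forall n, f n y = f n y') -> y = y') -> metrizable R Y.
Proof.
move=> cY Cf sepf; pose d y y' := wsup R (fun n => `|f n y' - f n y|).
have d0 y : d y y = 0.
  apply/eqP; rewrite eq_le wsup_ge0 andbT; apply: wsup_le => n.
  by rewrite /wterm subrr !normr0 /Num.min ltNge ler01 /= mul0r.
have dpos y y' : y <> y' -> 0 < d y y'.
  move=> yy'; have /existsNP[n fn] : ~ forall n, f n y = f n y' by move/sepf.
  by apply: (wsup_gt0 _ _ n); rewrite normr_eq0 subr_eq0; apply/eqP => E; apply: fn.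
have cd y : continuous (d y).
  apply: wsup_continuous => n y'; apply: (norm_sub_cvg _ _ (nbhs y')).
  exact: (Cf n).1.
exists d; split.
- move=> y y'; split => [dy|->]; last exact: d0.
  by apply: contrapT => /dpos; rewrite dy ltxx.
- by move=> y y'; congr wsup; apply/funext => n; rewrite distrC.
- move=> x y z; apply: wsup_triangle => n; rewrite !normr_id [leRHS]addrC.
  exact: ler_distD.
move=> A; split => [oA x Ax|Ad].
  apply: contrapT => nA.
  pose B (e : R) := [set y | d x y < e /\ ~ A y].
  have PB : ProperFilter (filter_from [set e : R | 0 < e] B).
    apply: filter_from_proper.
      apply: filter_from_filter; first by exists 1; rewrite /= ltr01.
      move=> e e' /= e0 e'0; exists (Num.min e e'); first by rewrite /= lt_min e0.
      by move=> y [+ nAy]; rewrite lt_min => /andP[].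
    move=> e e0; apply: contrapT => Be; apply: nA; exists e; split => // y dy.
    by apply: contrapT => nAy; apply: Be; exists y.
  have BT : filter_from [set e : R | 0 < e] B setT by exists 1; rewrite /= ?ltr01.
  have [y [_ By]] := cY _ PB BT.
  have [Ay|nAy] := pselect (A y).
    have BA : filter_from [set e : R | 0 < e] B (~` A).
      by exists 1; [rewrite /= ltr01|move=> z []].
    by have [z []] := By _ _ BA (open_nbhs_nbhs (conj oA Ay)).
  have dy : 0 < d x y by apply: dpos => xy; apply: nAy; rewrite -xy.
  have nd : nbhs (d x y) [set r : R | d x y / 2 < r].
    by apply: open_nbhs_nbhs; split; [exact: open_gt|rewrite /=; lra].
  have Bd : filter_from [set e : R | 0 < e] B (B (d x y / 2)).
    by exists (d x y / 2) => //=; lra.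
  have [z [[zd _]]] := By _ _ Bd (cd x y _ nd).
  by rewrite /= => /lt_trans/(_ zd); rewrite ltxx.
rewrite openE => x Ax; have [e [e0 eA]] := Ad x Ax.
have nd : nbhs (d x x) [set r : R | r < e].
  by apply: open_nbhs_nbhs; split; [exact: open_lt|rewrite /= d0].
have nx : nbhs x (d x @^-1` [set r : R | r < e]) := cd x x _ nd.
by apply: filterS nx => y /= /eA.
Qed.

Lemma compact_metrizable_bumps (X : topologicalType) :
  compact [set: X] -> metrizable R X ->
  exists b : nat -> X -> R, (forall n, continuous (b n)) /\
    forall x (S : seq X), exists n, b n x = 1 /\
      forall z, z \in S -> z != x -> b n z = 0.
Proof.
move=> cX [d [d0 dC dT dO]].
have dxx x : d x x = 0 by exact/d0.
have dge0 x y : 0 <= d x y by have := dT x y x; rewrite dxx dC; lra.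
have nball x e : 0 < e -> nbhs x [set y | d x y < e].
  move=> e0; apply: open_nbhs_nbhs; split; last by rewrite /= dxx.
  apply/dO => y /= xy; exists (e - d x y); split; first lra.
  by move=> z; have := dT x y z; lra.
have cd q : continuous (d q).
  move=> y; apply/cvgrPdist_lt => e e0; apply: filterS (nball y e e0) => z /= yz.
  have := dT q y z; have := dT q z y; rewrite (dC z y) ltr_norml; lra.
have net e : 0 < e -> exists s : seq X, forall x, exists2 q, q \in s & d q x < e.
  move=> e0; apply: contrapT => ns.
  pose B (s : seq X) := [set x | forall q, q \in s -> e <= d q x].
  have PB : ProperFilter (filter_from setT B).
    apply: filter_from_proper.
      apply: filter_from_filter; first by exists [::].
      move=> s s' _ _; exists (s ++ s') => // x sx.
      by split => q qs; apply: sx; rewrite mem_cat qs ?orbT.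
    move=> s _; apply: contrapT => Bs; apply: ns; exists s => x.
    apply: contrapT => nx; apply: Bs; exists x => q qs; rewrite leNgt.
    by apply/negP => qx; apply: nx; exists q.
  have BT : filter_from setT B setT by exists [::].
  have [x [_ Bx]] := cX _ PB BT.
  have Bx1 : filter_from setT B (B [:: x]) by exists [:: x].
  have [z [/(_ x (mem_head _ _))]] := Bx _ _ Bx1 (nball x e e0).
  by rewrite leNgt => /negP.
have /choice[s sP] : forall k : nat, exists s : seq X,
    forall x, exists2 q, q \in s & d q x < k.+1%:R^-1.
  by move=> k; apply: net; rewrite invr_gt0.
pose bump (k : nat) (q z : X) : R :=
  1 - Num.max 0 (1 - Num.max 0 (2 - k.+1%:R * d q z)).
have cbump k q : continuous (bump k q).
  move=> z; apply: cvgB; first exact: cvg_cst.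
  apply: (max0_cvg _ _ (nbhs z)); apply: cvgB; first exact: cvg_cst.
  apply: (max0_cvg _ _ (nbhs z)); apply: cvgB; first exact: cvg_cst.
  by apply: cvgM; [exact: cvg_cst|exact: cd].
pose b (n : nat) : X -> R := if @unpickle (nat * nat)%type n is Some (k, i) then
  if ohead (drop i (s k)) is Some q then bump k q else fun=> 0 else fun=> 0.
exists b; split.
  move=> n; rewrite /b; case: unpickle => [[k i]|]; last exact: cst_continuous.
  by case: ohead => [q|]; [exact: cbump|exact: cst_continuous].
move=> x S.
have [r r0 rS] : exists2 r, 0 < r & forall z, z \in S -> z != x -> r <= d x z.
  elim: S => [|y S [r r0 rS]]; first by exists 1.
  have [->|yx] := eqVneq y x.
    exists r => // z; rewrite inE => /orP[/eqP->|]; [by rewrite eqxx|exact: rS].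
  have xy : 0 < d x y.
    by rewrite lt_neqAle dge0 andbT eq_sym; apply: contra_neq yx => /d0.
  exists (Num.min r (d x y)); first by rewrite lt_min r0.
  move=> z; rewrite inE => /orP[/eqP->|zS zx]; rewrite ge_min ?lexx ?orbT//.
  by rewrite rS.
pose k := Num.trunc (3 / r).
have kr : 3 < k.+1%:R * r by rewrite -ltr_pdivrMr//; exact: truncnS_gt.
have [q qs qx] := sP k x.
have {}qx : k.+1%:R * d q x < 1 by rewrite -ltr_pdivlMl// mulr1.
exists (pickle (k, index q (s k))).
rewrite /b pickleK (drop_nth q) ?index_mem//= nth_index//; split.
  rewrite /bump; set a := 2 - _; have a1 : 1 < a by rewrite /a; lra.
  have -> : Num.max 0 a = a by apply/max_idPr; lra.
  have -> : Num.max 0 (1 - a) = 0 by apply/max_idPl; lra.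
  exact: subr0.
move=> z zS zx; have := rS z zS zx; rewrite -(ler_pM2l (ltr0Sn R k)).
have : k.+1%:R * d x z <= k.+1%:R * d q x + k.+1%:R * d q z.
  by rewrite -mulrDr ler_pM2l// (dC q x).
move=> h1 h2; rewrite /bump; have -> : Num.max 0 (2 - k.+1%:R * d q z) = 0.
  by apply/max_idPl; lra.
by rewrite subr0 (max_idPr ler01) subrr.
Qed.

Lemma metrizable_transfer (X Y : topologicalType) Phi Psi :
  tychonoff_space R X -> tychonoff_space R Y -> Cp_iso R X Y Phi Psi ->
  compact [set: Y] -> compact [set: X] -> metrizable R X -> metrizable R Y.
Proof.
move=> tX tY iso cY cX mX; have [b [cb bP]] := compact_metrizable_bumps X cX mX.
pose g (n : nat) (m : int) (z : X) := expi R (pi / m%:~R * b n z).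
have Cg n m : CT R X (g n m) by exact: CT_expiZ.
pose f (k : nat) := if @unpickle (nat * int)%type k is Some nm then Phi (g nm.1 nm.2)
  else fun=> cone R.
apply: (separating_sequence_metrizable Y f cY).
  move=> k; rewrite /f; case: unpickle => [nm|]; last by apply: CT_cst; exact: circle1.
  by have [PC _ _ _ _] := iso; exact: PC.
move=> y y' fy; apply: contrapT => yy'.
have [x [S [m [_ mP]]]] := Cp_iso_separation R X Y Phi Psi tX tY iso y y' yy'.
have [n [bx bS]] := bP x S; apply: (mP (b n)) => //.
by have := fy (pickle (n, m)); rewrite /f pickleK.
Qed.

End metrizability.

(** * Clopen sets *)

Section clopen_functions.
Variable R : realType.

Lemma clopen_if_continuous (X T : topologicalType) (U : set X) (a b : T) :
  clopen U -> continuous (fun x => if `[< U x >] then a else b).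
Proof.
move=> [oU cU] x; apply: cvg_near_cst; have [Ux|nUx] := pselect (U x).
  apply: filterS (open_nbhs_nbhs (conj oU Ux)) => z Uz.
  by rewrite !asboolT.
have oC : open (~` U) by rewrite openC.
apply: filterS (open_nbhs_nbhs (conj oC nUx)) => z Uz.
by rewrite !asboolF.
Qed.

Lemma pi_div_itv M : (0 < M)%N -> 0 < (pi : R) / M%:R <= pi.
Proof.
move=> M0; have pi0 := pi_gt0 R; have M1 : 0 < M%:R :> R by rewrite ltr0n.
by rewrite divr_gt0//= ler_pdivrMr// ler_peMr ?ler1n// ltW.
Qed.

Lemma circle_root_isolated (p : R * R) M : (0 < M)%N -> circle R p ->
  iter M (circle_mul p) (cone R) = cone R -> cos (pi / M%:R) < p.1 -> p = cone R.
Proof.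
move=> M0 /circle_lift[t tpi ->]; rewrite iter_expi => /expi_eq1[z zE] /= ct.
have pi0 := pi_gt0 R; have M1 : 0 < M%:R :> R by rewrite ltr0n.
have tM : `|t| < pi / M%:R.
  have /andP[pM0 pM1] := pi_div_itv M M0.
  by apply: cos_gt_lt => //; rewrite ltW.
have : `|M%:R * t| < pi by rewrite normrM gtr0_norm// mulrC -ltr_pdivlMr.
have pi2 : 0 < pi *+ 2 :> R by rewrite mulr2n; lra.
rewrite zE normrM (gtr0_norm pi2) => zpi.
have z0 : z = 0.
  apply/eqP/negP => /negP z0; move: zpi; rewrite ltNge => /negP; apply.
  have z1 : 1 <= `|z%:~R : R|.
    by rewrite -intr_norm -[1]/(1%:~R) ler_int -gtz0_ge1 normr_gt0.
  have : pi *+ 2 <= `|z%:~R| * (pi *+ 2) :> R by rewrite ler_peMl// ltW.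
  by rewrite mulr2n; lra.
move: zE; rewrite z0 mul0r => /eqP; rewrite mulf_eq0 gt_eqF//= => /eqP->.
exact: expi0.
Qed.

Lemma open_gt_fst (X : topologicalType) (f : X -> R * R) (c : R) :
  continuous f -> open [set x | c < (f x).1].
Proof.
move=> cf; apply: (@open_comp _ _ (fun x => (f x).1) [set r : R | c < r]).
  by move=> x _; exact: (fst_cvg _ _ (nbhs x) f _ (cf x)).
exact: open_gt.
Qed.

Lemma closed_fiber (X : topologicalType) (f : X -> R * R) (p : R * R) :
  continuous f -> closed [set x | f x = p].
Proof.
move=> cf; apply: (@closed_comp _ _ f [set p]) => [x _|]; first exact: cf.
apply: accessible_closed_set1; apply: hausdorff_accessible.
exact: (@norm_hausdorff R (R * R)%type).
Qed.

Lemma clopen_root_fiber (X : topologicalType) (f : X -> R * R) M : (0 < M)%N ->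
  CT R X f -> (forall x, iter M (circle_mul (f x)) (cone R) = cone R) ->
  clopen [set x | f x = cone R].
Proof.
move=> M0 [cf Cf] fM; split; last exact: closed_fiber.
have -> : [set x | f x = cone R] = [set x | cos (pi / M%:R) < (f x).1].
  apply/seteqP; split => x /=; last exact: circle_root_isolated.
  have /andP[pM pM1] := pi_div_itv M M0.
  have i1 : 0 <= (pi : R) / M%:R <= pi by rewrite ltW.
  have i2 : 0 <= (0 : R) <= pi by rewrite lexx (le_trans (ltW pM)).
  by move=> -> /=; rewrite -[X in _ < X]cos0 ltr_cos ?in_itv.
exact: open_gt_fst.
Qed.

Section transfer.
Variables (X Y : topologicalType).
Variables (Phi : {ptws X -> (R * R)%type} -> {ptws Y -> (R * R)%type}).
Variables (Psi : {ptws Y -> (R * R)%type} -> {ptws X -> (R * R)%type}).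
Hypothesis iso : Cp_iso R X Y Phi Psi.

Lemma Cp_iso_iter k f : CT R X f ->
  CT R X (fun x => iter k (circle_mul (f x)) (cone R)) /\
  Phi (fun x => iter k (circle_mul (f x)) (cone R)) =
  fun y => iter k (circle_mul (Phi f y)) (cone R).
Proof.
move=> Cf; have [PC _ _ _ [Pm _ _]] := iso.
have C1 : CT R X (fun=> cone R) by apply: CT_cst; exact: circle1.
elim: k => [|k [Ck IH]] /=.
  split => //; apply/funext => y; have [F cF] := Cp_iso_character R X Y Phi Psi y iso.
  exact: (character_one R X _ _ cF).
by split; [exact: CT_CT_mul|rewrite (Pm f) ?IH].
Qed.

Lemma Cp_iso_root M f : CT R X f ->
  (forall x, iter M (circle_mul (f x)) (cone R) = cone R) ->
  forall y, iter M (circle_mul (Phi f y)) (cone R) = cone R.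
Proof.
move=> Cf fM y; have [_ /(congr1 (@^~ y)) <-] := Cp_iso_iter M f Cf.
have [_ /(congr1 (@^~ y))] := Cp_iso_iter 0 f Cf; rewrite /= => {2}<-.
by congr (Phi _ y); apply/funext.
Qed.

Lemma zero_dimensional_transfer : tychonoff_space R X -> tychonoff_space R Y ->
  zero_dimensional X -> zero_dimensional Y.
Proof.
move=> tX tY zX y y' /eqP yy'; have [PC _ _ _ _] := iso.
have [x [S [m [m0 mP]]]] := Cp_iso_separation R X Y Phi Psi tX tY iso y y' yy'.
have [U [cU Ux US]] : exists U : set X, [/\ clopen U, U x &
    forall z, z \in S -> z != x -> ~ U z].
  elim: S {mP} => [|z S [U [[oU cU] Ux US]]].
    by exists setT; split => //; split; [exact: openT|exact: closedT].
  have [->|zx] := eqVneq z x.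
    exists U; split => // t; rewrite inE => /orP[/eqP->|]; [by rewrite eqxx|exact: US].
  have [V [[oV cV] Vx Vz]] : exists V : set X, [/\ clopen V, V x & ~ V z].
    by apply: zX; rewrite eq_sym.
  exists (U `&` V); split => //; first by split; [exact: openI|exact: closedI].
  by move=> t; rewrite inE => /orP[/eqP-> _ [_ /Vz]|tS tx [/(US t tS tx)]].
pose b z : R := if `[< U z >] then 1 else 0.
have cb : continuous b by exact: clopen_if_continuous.
set g := fun z => expi R (pi / m%:~R * b z) in mP *.
have Cg : CT R X (fun z => expi R (pi / m%:~R * b z)) by exact: CT_expiZ.
have gneq : Phi (fun z => expi R (pi / m%:~R * b z)) y <>
    Phi (fun z => expi R (pi / m%:~R * b z)) y'.
  apply: mP => //; first by rewrite /b asboolT.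
  by move=> z zS zx; rewrite /b asboolF//; exact: US.
set G := Phi _ in gneq; have CG : CT R Y G by exact: PC.
pose M := (`|m| * 2)%N.
have gM z : iter M (circle_mul (expi R (pi / m%:~R * b z))) (cone R) = cone R.
  rewrite iter_expi /b; case: ifP => _; last by rewrite !mulr0 expi0.
  have m1 : m%:~R != 0 :> R by rewrite intr_eq0.
  rewrite mulr1 /M natrM natr_absz.
  have [mge0|mlt0] := leP 0 m.
    by rewrite ger0_norm// -[RHS](expi_2pi R 1); congr expi; rewrite mulr2n; field.
  rewrite ltr0_norm// -[RHS](expi_2pi R (-1)); congr expi.
  by rewrite !intrN mulr2n; field.
have GM : forall t, iter M (circle_mul (G t)) (cone R) = cone R by exact: Cp_iso_root.
have M0 : (0 < M)%N by rewrite muln_gt0 absz_gt0 m0.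
pose h t := circle_mul (G t) (cconj R (G y)).
have cGy : circle R (G y) by exact: CT_circle.
have Ch : CT R Y h.
  apply: (CT_CT_mul R Y G (fun=> cconj R (G y))) => //.
  by apply: CT_cst; exact: circle_conj.
have hM t : iter M (circle_mul (h t)) (cone R) = cone R.
  have := GM t; have := GM y; rewrite /h.
  have [s _ ->] := circle_lift R _ cGy.
  have [s' _ ->] := circle_lift R _ (CT_circle R Y G t CG).
  rewrite -expiN -expiD !iter_expi mulrDr expiD mulrN expiN => -> ->.
  by rewrite cmulpV//; exact: circle1.
exists [set t | h t = cone R]; split => [||hy'].
- exact: (clopen_root_fiber Y h M).
- exact: cmulpV.
- apply: gneq; apply: (@cmul_inj R (cconj R (G y))); first exact: circle_conj.
  by rewrite ![circle_mul (cconj R (G y)) _]cmulC cmulpV.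
Qed.

(* A clopen set [U] corresponds to the involution equal to [1] on [U] and to [-1]
   off [U]. *)
Lemma clopen_injection : exists theta : set X -> set Y,
  (forall U, clopen U -> clopen (theta U)) /\
  (forall U V, clopen U -> clopen V -> theta U = theta V -> U = V).
Proof.
have [PC QC QP PQ _] := iso.
pose s (U : set X) (x : X) := if `[< U x >] then cone R else expi R pi.
have Cs U : clopen U -> CT R X (s U).
  move=> cU; split; first exact: clopen_if_continuous.
  by move=> x; rewrite /s; case: ifP => _; [exact: circle1|exact: circle_expi].
have s2 U x : iter 2 (circle_mul (s U x)) (cone R) = cone R.
  rewrite /s; case: ifP => _; first by rewrite /= !cmul1p.
  by rewrite iter_expi mulr_natl; rewrite /expi cos2pi sin2pi.
have P2 U y : clopen U -> iter 2 (circle_mul (Phi (s U) y)) (cone R) = cone R.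
  by move=> cU; apply: Cp_iso_root => //; exact: Cs.
have val (p : R * R) : circle R p -> iter 2 (circle_mul p) (cone R) = cone R ->
    p <> cone R -> p = expi R pi.
  case: p => a b; rewrite /circle /cone /circle_mul /= expipi => ab [h _] p1.
  have b0 : b ^+ 2 = 0 by rewrite !expr2 in ab *; lra.
  have {b0}b0 : b = 0 by move/eqP: b0; rewrite sqrf_eq0 => /eqP.
  move: ab p1; rewrite b0 expr0n addr0 => /eqP.
  by rewrite sqrf_eq1 => /orP[]/eqP->.
exists (fun U => [set y | Phi (s U) y = cone R]); split => [U cU|U V cU cV UV].
  apply: (clopen_root_fiber Y _ 2) => //; first by apply: PC; exact: Cs.
  by move=> y; exact: P2.
have E : Phi (s U) = Phi (s V).
  apply/funext => y; have CU := CT_circle R Y _ y (PC _ (Cs _ cU)).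
  have CV := CT_circle R Y _ y (PC _ (Cs _ cV)).
  have [yU|yU] := pselect (Phi (s U) y = cone R).
    rewrite yU; apply: esym.
    by have : [set y | Phi (s U) y = cone R] y by []; rewrite UV.
  have yV : Phi (s V) y <> cone R.
    by move=> yV; apply: yU; have : [set y | Phi (s V) y = cone R] y by []; rewrite -UV.
  by rewrite (val _ CU (P2 _ _ cU) yU) (val _ CV (P2 _ _ cV) yV).
have {}E : s U = s V by rewrite -(QP _ (Cs _ cU)) E QP//; exact: Cs.
have neq : cone R <> expi R pi by rewrite expipi => -[]; lra.
apply/seteqP; split => x.
  move=> Ux; apply: contrapT => nVx; apply: neq.
  by have := congr1 (@^~ x) E; rewrite /s asboolT// asboolF.
move=> Vx; apply: contrapT => nUx; apply: neq.
by have := congr1 (@^~ x) E; rewrite /s asboolF// asboolT.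
Qed.

End transfer.
End clopen_functions.

Section components.
Variable X : topologicalType.

Lemma component_clopen_sub (U : set X) x : clopen U -> U x ->
  connected_component [set: X] x `<=` U.
Proof.
move=> [oU cU] Ux y xy.
have E : connected_component [set: X] x `&` U = connected_component [set: X] x.
  apply: (@component_connected X [set: X] x); last by exists U.
    by exists x; split => //; exact: connected_component_refl.
  by exists U.
by move: xy; rewrite -E => -[].
Qed.

Lemma connected_clopen : connected [set: X] <->
  (forall U : set X, clopen U -> U = set0 \/ U = setT).
Proof.
split => [cX U [oU cU]|cU B B0 [C oC BC] [D cD BD]].
  have [->|U0] := eqVneq U set0; first by left.
  by right; apply: cX; [exact/set0P|exists U => //; rewrite setTI|exists U => //; rewrite setTI].
rewrite setTI in BC; rewrite setTI in BD.
have [|B0'|//] := cU B; first by split; [rewrite BC|rewrite BD].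
by move: B0; rewrite B0' => -[].
Qed.

Lemma finite_components : finite_set [set U : set X | clopen U] ->
  finite_set (components X).
Proof.
move=> finU; apply: sub_finite_set (finU) => _ [x _ <-].
pose Q := \bigcap_(U in [set U : set X | clopen U /\ U x]) U.
have finUx : finite_set [set U : set X | clopen U /\ ~ U x].
  by apply: sub_finite_set (finU) => U [].
have QE : ~` Q = \bigcup_(U in [set U : set X | clopen U /\ ~ U x]) U.
  apply/seteqP; split => y.
    move=> /existsNP[U /not_implyP[[[oU cU] Ux] Uy]].
    by exists (~` U) => //; split; [split; [rewrite openC|rewrite closedC]|move=> /(_ Ux)].
  move=> [U [[oU cU] Ux] Uy] /(_ (~` U)); apply => //.
  by split => //; split; [rewrite openC|rewrite closedC].
have cQ : clopen Q.
  split; last by apply: closed_bigI => U [[]].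
  rewrite -[Q]setCK QE openC; apply: closed_bigcup => //.
  by move=> U [[]].
have Qx : Q x by move=> U [].
suff -> : connected_component [set: X] x = Q by [].
apply/seteqP; split; first by move=> y xy U [cU Ux]; exact: (component_clopen_sub U x).
apply: connected_component_max => //.
move=> B [b Bb] [C oC BC] [D cD BD].
have [oB cB] : open B /\ closed B.
  by split; [rewrite BC; apply: openI => //; exact: cQ.1
    |rewrite BD; apply: closedI => //; exact: cQ.2].
have BQ : B `<=` Q by rewrite BC => ? [].
apply/seteqP; split => // y Qy.
have [Bx|nBx] := pselect (B x); first exact: Qy.
have : ~ B b; last by [].
by apply: (BQ b Bb (~` B)); split => //; split; [rewrite openC|rewrite closedC].
Qed.

Lemma clopen_enumeration n : has_n_components X n ->
  exists f : {set 'I_n} -> set X, injective f /\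
    forall U, clopen U <-> exists A, f A = U.
Proof.
move=> nX.
have /card_set_bijP[c [cfun cinj csurj]] : (`I_n #= components X)%card.
  by rewrite card_eq_sym.
have cP (i : 'I_n) x : c i x -> c i = connected_component [set: X] x.
  have [z _ <-] := cfun i (ltn_ord i).
  exact: same_connected_component.
have cx x : exists i : 'I_n, c i x.
  have [i /= ni iE] := csurj (connected_component [set: X] x) (ex_intro2 _ _ x I erefl).
  by exists (Ordinal ni); rewrite /= iE; exact: connected_component_refl.
have cI (i j : 'I_n) x : c i x -> c j x -> i = j.
  move=> ix jx; apply: val_inj; apply: cinj; rewrite ?inE //=.
  by rewrite (cP i x ix) (cP j x jx).
have ne (i : 'I_n) : c i !=set0.
  by have [z _ <-] := cfun i (ltn_ord i); exists z; exact: connected_component_refl.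
pose f (A : {set 'I_n}) := [set x | exists2 i, i \in A & c i x].
have fC A : ~` f A = f (~: A)%SET.
  apply/seteqP; split => x.
    move=> nx; have [i ix] := cx x; exists i => //; rewrite inE.
    by apply/negP => iA; apply: nx; exists i.
  by move=> [i + ix] [j jA jx]; rewrite inE (cI i j x ix jx) jA.
have clf A : closed (f A).
  have -> : f A = \bigcup_(i in [set i | i \in A]) c i.
    by apply/seteqP; split => x [i iA ix]; exists i.
  apply: closed_bigcup; first exact: finite_finset.
  move=> i _; have [z _ <-] := cfun i (ltn_ord i).
  by apply: component_closed; exact: closedT.
exists f; split.
  have sub A B : f A = f B -> A \subset B.
    move=> AB; apply/fintype.subsetP => i iA; have [x ix] := ne i.
    have : f B x by rewrite -AB; exists i.
    by move=> [j jB jx]; rewrite (cI i j x ix jx).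
  by move=> A B AB; apply/eqP; rewrite finset.eqEsubset !sub.
move=> U; split => [cU|[A <-]]; last first.
  by split => //; rewrite -[f A]setCK fC openC.
exists [set i : 'I_n | `[< c i `<=` U >]]%SET; apply/seteqP; split => x.
  by move=> [i]; rewrite inE => /asboolP iU /iU.
move=> Ux; have [i ix] := cx x; exists i => //; rewrite inE; apply/asboolP.
by rewrite (cP i x ix); exact: component_clopen_sub.
Qed.

End components.

Lemma clopen_injection_leq (X Y : topologicalType) m n (theta : set X -> set Y) :
  (forall U, clopen U -> clopen (theta U)) ->
  (forall U V, clopen U -> clopen V -> theta U = theta V -> U = V) ->
  has_n_components X m -> has_n_components Y n -> (m <= n)%N.
Proof.
move=> tc ti /clopen_enumeration[f [fI fP]] /clopen_enumeration[g [gI gP]].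
have cf A : clopen (f A) by apply/fP; exists A.
have /choice[h hP] : forall A, exists B, g B = theta (f A).
  by move=> A; apply/gP; exact: tc.
have hI : injective h by move=> A B AB; apply: fI; apply: ti => //; rewrite -!hP AB.
have card2 k : #|{set 'I_k}| = (2 ^ k)%N.
  by rewrite -cardsT -powersetT card_powerset cardsT card_ord.
by have := leq_card h hI; rewrite !card2 leq_exp2l.
Qed.

Lemma has_n_components_transfer (R : realType) (X Y : topologicalType) Phi Psi n :
  Cp_iso R X Y Phi Psi -> has_n_components X n -> has_n_components Y n.
Proof.
move=> iso nX.
have [t [tc ti]] := clopen_injection R X Y Phi Psi iso.
have [t' [tc' ti']] := clopen_injection R Y X Psi Phi (Cp_iso_sym _ _ _ _ _ iso).
have finY : finite_set [set U : set Y | clopen U].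
  have [f [_ fP]] := clopen_enumeration X n nX.
  have finX : finite_set [set U : set X | clopen U].
    apply: (@sub_finite_set _ _ (range f)); last exact: finite_image.
    by move=> U /fP[A <-]; exists A.
  have /choice[r rP] : forall W, exists V, (exists2 V, clopen V & t' V = W) ->
      clopen V /\ t' V = W.
    move=> W; have [[V cV VW]|nW] := pselect (exists2 V, clopen V & t' V = W).
      by exists V.
    by exists set0 => /nW.
  apply: (@sub_finite_set _ _ (r @` [set U : set X | clopen U])); last exact: finite_image.
  move=> V cV; exists (t' V); first exact: tc'.
  by have [|cr /ti' ->] := rP (t' V); first by exists V.
have /finite_setP[m mY] := finite_components Y finY.
suff -> : n = m by [].
apply/eqP; rewrite eqn_leq (clopen_injection_leq X Y _ _ t)//.
exact: (clopen_injection_leq Y X _ _ t').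
Qed.

Lemma connected_transfer (R : realType) (X Y : topologicalType) Phi Psi :
  Cp_iso R X Y Phi Psi -> connected [set: X] -> connected [set: Y].
Proof.
move=> iso /connected_clopen cX; apply/connected_clopen => V cV.
have [t [tc ti]] := clopen_injection R Y X Psi Phi (Cp_iso_sym _ _ _ _ _ iso).
have c0 : clopen (set0 : set Y) by split; [exact: open0|exact: closed0].
have cT : clopen [set: Y] by split; [exact: openT|exact: closedT].
have [E0|E0] := cX _ (tc _ c0); have [ET|ET] := cX _ (tc _ cT);
  have [EV|EV] := cX _ (tc _ cV).
- by left; apply: ti => //; rewrite EV.
- have E : set0 = [set: Y] by apply: ti => //; rewrite E0.
  by left; apply/seteqP; split => // y _; rewrite E.
- by left; apply: ti => //; rewrite EV.
- by right; apply: ti => //; rewrite EV.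
- by right; apply: ti => //; rewrite EV.
- by left; apply: ti => //; rewrite EV.
- have E : set0 = [set: Y] by apply: ti => //; rewrite E0.
  by left; apply/seteqP; split => // y _; rewrite E.
- by left; apply: ti => //; rewrite EV.
Qed.

Section compact_transfer.
Variables (R : realType).

Lemma compact_pseudocompact (X : topologicalType) :
  compact [set: X] -> pseudocompact R X.
Proof.
move=> cX f cf.
have /compact_bounded[M [_ MP]] : compact (f @` [set: X]).
  by apply: continuous_compact => //; exact: continuous_subspaceT.
exists (M + 1) => x; apply: (MP (M + 1)); first by rewrite ltrDl.
by exists x.
Qed.

Lemma compact_sigma_compact (X : topologicalType) :
  compact [set: X] -> sigma_compact X.
Proof.
by move=> cX; exists (fun=> setT); split => //; apply/seteqP; split => // x _; exists 0%N.
Qed.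

Lemma compact_transfer (X Y : topologicalType) Phi Psi :
  tychonoff_space R X -> tychonoff_space R Y -> Cp_iso R X Y Phi Psi ->
  compact [set: X] -> compact [set: Y].
Proof.
move=> tX tY iso cX; apply: (sigma_compact_pseudocompact R) => //.
  by apply: (pseudocompact_transfer R X Y Phi Psi iso); exact: compact_pseudocompact.
apply: sigma_compact_power_image (compact_sigma_compact _ cX).
exact: (Cp_iso_power_image R X Y Phi Psi).
Qed.

End compact_transfer.


Theorem theorem10p7 (R : realType) (X Y : topologicalType) :
  tychonoff_space R X -> tychonoff_space R Y -> Cp_top_isomorphic R X Y ->
  [/\ (pseudocompact R X <-> pseudocompact R Y),
      (forall K : Type, infinite_set [set: K] -> (lstar_le X K <-> lstar_le Y K)),
      (lindelof_sigma X <-> lindelof_sigma Y),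
      (sigma_compact X <-> sigma_compact Y) &
   [/\ (compact [set: X] <-> compact [set: Y]),
       (compact [set: X] /\ metrizable R X <-> compact [set: Y] /\ metrizable R Y),
       (forall n : nat, (0 < n)%N -> (has_n_components X n <-> has_n_components Y n)),
       (connected [set: X] <-> connected [set: Y]) &
       (zero_dimensional X <-> zero_dimensional Y)]].
Proof.
move=> tX tY [Phi [Psi iso]].
have iso' : Cp_iso R Y X Psi Phi by exact: Cp_iso_sym.
have pXY := Cp_iso_power_image R X Y Phi Psi tX tY iso.
have pYX := Cp_iso_power_image R Y X Psi Phi tY tX iso'.
have cXY := compact_transfer R X Y Phi Psi tX tY iso.
have cYX := compact_transfer R Y X Psi Phi tY tX iso'.
split; [split|move=> K infK; split|split|split|split].
- exact: (pseudocompact_transfer R X Y Phi Psi iso).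
- exact: (pseudocompact_transfer R Y X Psi Phi iso').
- exact: lstar_power_image.
- exact: lstar_power_image.
- exact: lindelof_sigma_power_image.
- exact: lindelof_sigma_power_image.
- exact: sigma_compact_power_image.
- exact: sigma_compact_power_image.
- by split.
- split=> -[cZ mZ].
    by split; [exact: cXY|apply: (metrizable_transfer R X Y Phi Psi) => //; exact: cXY].
  by split; [exact: cYX|apply: (metrizable_transfer R Y X Psi Phi) => //; exact: cYX].
- move=> n _; split; [exact: (has_n_components_transfer R X Y Phi Psi)
    |exact: (has_n_components_transfer R Y X Psi Phi)].
- split; [exact: (connected_transfer R X Y Phi Psi)
    |exact: (connected_transfer R Y X Psi Phi)].
- split; [exact: (zero_dimensional_transfer R X Y Phi Psi)
    |exact: (zero_dimensional_transfer R Y X Psi Phi)].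
Qed.
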